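(* Let $T\in{\rm Aut}(X,\mathcal B,\mu)$ be ergodic with measure-theoretic entropy $h(T)=0$. Then the topological entropy of the topological lens $(C_2(\mu),\widetilde T)$ is zero.
   Context: $C_2(\mu)$: probability measures on $X\times X$ with both marginals $\mu$, with the compact metrizable topology $\rho_n\to\rho$ iff $\rho_n(A\times B)\to\rho(A\times B)$ for all measurable $A,B$; the topological lens is $\widetilde T(\rho)(A\times B)=\rho(T^{-1}A\times T^{-1}B)$. *)

(* Defs.v *)
From HB Require Import structures.
From mathcomp Require Import all_boot all_order all_algebra.
From mathcomp Require Import all_classical all_reals all_analysis.
Set Implicit Arguments. Unset Strict Implicit. Unset Printing Implicit Defensive.
Import Order.TTheory GRing.Theory Num.Theory.
Import numFieldNormedType.Exports.
Local Open Scope classical_set_scope.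
Local Open Scope ring_scope.

(* (X,B) is a standard Borel space: Borel isomorphic to a Borel subset of R
   (Kuratowski's characterization of standard Borel spaces). *)
Definition standard_borel d (X : measurableType d) (R : realType) : Prop :=
  exists (S : set R) (f : X -> R) (g : R -> X),
    [/\ measurable S, measurable_fun setT f, measurable_fun S g,
        (forall x, S (f x)) &
        (forall x, g (f x) = x) /\ (forall y, S y -> f (g y) = y)].

Definition mp_automorphism d (X : measurableType d) (R : realType)
  (mu : set X -> \bar R) (T : X -> X) : Prop :=
  exists Tinv : X -> X,
    [/\ cancel T Tinv, cancel Tinv T,
        measurable_fun setT T, measurable_fun setT Tinv &
        forall A, measurable A -> mu (T @^-1` A) = mu A].

Definition ergodic d (X : measurableType d) (R : realType)
  (mu : set X -> \bar R) (T : X -> X) : Prop :=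
  forall A, measurable A -> T @^-1` A = A -> mu A = 0%E \/ mu A = 1%E.

Definition fin_partition d (X : measurableType d) (k : nat)
  (P : 'I_k -> set X) : Prop :=
  [/\ forall i, measurable (P i),
      forall i j, i != j -> P i `&` P j = set0 &
      \bigcup_i P i = setT].

Definition join_cell (X : Type) (k n : nat) (T : X -> X) (P : 'I_k -> set X)
  (w : {ffun 'I_n -> 'I_k}) : set X :=
  \bigcap_(i in [set: 'I_n]) (iter i T) @^-1` (P (w i)).

Definition eta (R : realType) (t : R) : R := if t == 0 then 0 else - (t * ln t).

Definition join_entropy d (X : measurableType d) (R : realType)
  (mu : set X -> \bar R) (T : X -> X) (k : nat) (P : 'I_k -> set X) (n : nat) : R :=
  \sum_(w : {ffun 'I_n -> 'I_k}) eta (fine (mu (join_cell T P w))).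

Definition ms_entropy_part d (X : measurableType d) (R : realType)
  (mu : set X -> \bar R) (T : X -> X) (k : nat) (P : 'I_k -> set X) : R :=
  limn (fun n : nat => join_entropy mu T P n / n%:R).

Definition ms_entropy d (X : measurableType d) (R : realType)
  (mu : set X -> \bar R) (T : X -> X) : \bar R :=
  ereal_sup [set x | exists (k : nat) (P : 'I_k -> set X),
                       fin_partition P /\ x = (ms_entropy_part mu T P)%:E].

(* For a space K (a subset of a carrier Y) whose open sets are given by
   op (open relative to K: only traces on K matter), and f : K -> K. *)

Definition cover_number (Y : Type) (K : set Y) (f : Y -> Y) (k : nat)
  (U : 'I_k -> set Y) (n : nat) : nat :=
  \big[minn/#|[set: {ffun 'I_n -> 'I_k}]|]_(S : {set {ffun 'I_n -> 'I_k}} |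
      `[< K `<=` \bigcup_(w in [set w | w \in S]) join_cell f U w >]) #|S|.

Definition cover_entropy (R : realType) (Y : Type) (K : set Y) (f : Y -> Y)
  (k : nat) (U : 'I_k -> set Y) : R :=
  limn (fun n : nat => ln ((cover_number K f U n)%:R : R) / n%:R).

Definition top_entropy (R : realType) (Y : Type) (op : set Y -> Prop)
  (K : set Y) (f : Y -> Y) : \bar R :=
  ereal_sup [set x | exists (k : nat) (U : 'I_k -> set Y),
     [/\ forall i, op (U i), K `<=` \bigcup_i U i &
         x = (cover_entropy R K f U)%:E]].

Definition coupling d (X : measurableType d) (R : realType)
  (mu : set X -> \bar R) (m : set (X * X) -> \bar R) : Prop :=
  exists rho : probability (X * X)%type R,
    (rho : set (X * X) -> \bar R) = m /\
    forall A, measurable A -> rho (A `*` setT) = mu A /\ rho (setT `*` A) = mu A.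

(* open sets of C_2(mu): the coarsest topology making all maps
   rho |-> rho(A x B) (A, B measurable) continuous, i.e. the topology of
   convergence rho_n(A x B) -> rho(A x B) for all measurable A, B.
   (op O says that O meets C_2(mu) in a relatively open set.) *)
Definition lens_open d (X : measurableType d) (R : realType)
  (mu : set X -> \bar R) (O : set (set (X * X) -> \bar R)) : Prop :=
  forall m, coupling mu m -> O m ->
    exists (n : nat) (A B : 'I_n -> set X) (e : R),
      [/\ 0 < e, forall i, measurable (A i) /\ measurable (B i) &
          forall m', coupling mu m' ->
            (forall i, `| fine (m' (A i `*` B i)) - fine (m (A i `*` B i)) | < e) ->
            O m'].

Definition lens d (X : measurableType d) (R : realType) (T : X -> X)
  (m : set (X * X) -> \bar R) : set (X * X) -> \bar R :=
  pushforward m (fun p : X * X => (T p.1, T p.2)).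

(* Main.v *)
Require Import Defs.
From HB Require Import structures.
From mathcomp Require Import all_boot all_order all_algebra.
From mathcomp Require Import all_classical all_reals all_analysis.
From mathcomp Require Import measurable_realfun ring lra.

(** The evolution of a coupling [m] under the lens, read on finitely many
    rectangles [A_j x B_j] for [n] steps, is a convex combination of 0/1 vectors
    indexed by pairs of [n]-names of the partition generated by the [A_j], [B_j].
    Zero entropy puts almost all the mass on [exp (s n)] names.  By Maurey's
    empirical method the average of a bounded number [M] of these vectors (with
    [M] independent of [n]) is close to the given combination on all but a small
    proportion of the [n] coordinates, and the exceptional coordinates are paid
    for by a Hamming ball.  Hence subexponentially many words suffice to cover.

    Passing from an arbitrary open cover to finitely many rectangles is the
    compactness of the space of couplings: a limit of couplings along an
    ultrafilter is finitely additive, and its countable subadditivity on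
    rectangles follows from the regularity of the common marginal [mu], which
    makes the subadditivity estimates uniform over all couplings. *)

Set Implicit Arguments. Unset Strict Implicit. Unset Printing Implicit Defensive.
Import Order.TTheory GRing.Theory Num.Theory.
Import numFieldNormedType.Exports.
Local Open Scope classical_set_scope.
Local Open Scope ring_scope.

(** * Finite convexity and entropy estimates *)

Lemma exists_le_average (R : realFieldType) (I : finType) (a f : I -> R) (c : R) :
  (forall i, 0 <= a i) -> \sum_i a i = 1 -> \sum_i a i * f i <= c ->
  exists i, f i <= c.
Proof.
move=> a0 a1 afc; apply: contrapT => fc.
have fc' i : c < f i by rewrite ltNge; apply/negP => h; apply: fc; exists i.
have ge0 i : 0 <= a i * (f i - c) by rewrite mulr_ge0// subr_ge0 ltW.
have s0 : \sum_i a i * (f i - c) = 0.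
  apply: le_anti; rewrite sumr_ge0 ?andbT//.
  under eq_bigr do rewrite mulrBr.
  by rewrite sumrB -mulr_suml a1 mul1r subr_le0.
have a_eq0 i : a i = 0.
  have := s0 => /eqP; rewrite psumr_eq0// => /allP/(_ i).
  rewrite mem_index_enum mulf_eq0 => /(_ isT) /orP[/eqP//|].
  by rewrite subr_eq0 gt_eqF.
by move: a1; rewrite big1// => /eqP; rewrite eq_sym oner_eq0.
Qed.

(* Greedy form of Maurey's empirical method: the expectation over the next
   sample of the squared error grows by at most the variance. *)
Lemma approx_caratheodory (R : realFieldType) (I C : finType) (a : I -> R)
    (x : I -> C -> R) (M : nat) :
  (forall i, 0 <= a i) -> \sum_i a i = 1 ->
  (forall i c, 0 <= x i c <= 1) ->
  exists t : M.-tuple I,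
    \sum_c (\sum_(i <- t) x i c - M%:R * \sum_i a i * x i c) ^+ 2
      <= M%:R * #|C|%:R.
Proof.
move=> a0 a1 x01; pose p c := \sum_i a i * x i c.
have p01 c : 0 <= p c <= 1.
  apply/andP; split.
    by apply: sumr_ge0 => i _; rewrite mulr_ge0//; case/andP: (x01 i c).
  by rewrite -a1; apply: ler_sum => i _; rewrite ler_piMr//; case/andP: (x01 i c).
elim: M => [|M [t tM]].
  by exists [tuple]; rewrite mul0r big1// => c _; rewrite big_nil mul0r subrr expr0n.
pose d c := \sum_(i <- t) x i c - M%:R * p c.
have [i iM] : exists i, \sum_c (d c + (x i c - p c)) ^+ 2 <= M.+1%:R * #|C|%:R.
  apply: (exists_le_average (a := a)) => //.
  under eq_bigr do rewrite mulr_sumr.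
  rewrite exchange_big/=.
  apply: (@le_trans _ _ (\sum_c (d c ^+ 2 + 1))); last first.
    rewrite big_split/= sumr_const -[in leRHS]natr1 mulrDl mul1r.
    by rewrite lerD2r.
  apply: ler_sum => c _.
  (* The cross term [2 * d c * (x i c - p c)] has average zero because [p c] is the mean of [x i c];
     what remains is a variance, at most 1 since all values lie in [0, 1]. *)
  rewrite (_ : \sum_i _ = d c ^+ 2 + \sum_i a i * (x i c - p c) ^+ 2).
    rewrite lerD2l -a1; apply: ler_sum => i _; rewrite ler_piMr//.
    have := p01 c; have := x01 i c; nra.
  transitivity (\sum_i (a i * (d c ^+ 2 - 2 * d c * p c)
     + 2 * d c * (a i * x i c) + a i * (x i c - p c) ^+ 2)).
    by apply: eq_bigr => i _; ring.
  by rewrite !big_split/= -mulr_suml a1 -mulr_sumr -/(p c); ring.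
exists [tuple of i :: t]; apply: le_trans iM; rewrite le_eqVlt; apply/orP; left.
apply/eqP/eq_bigr => c _; rewrite big_cons -/(p c) /d -natr1; ring.
Qed.

(** Give each word the weight [l] to the number of its disagreements with [v]. Words of the ball
    weigh at least [l ^+ D] because [l <= 1], while the total weight factors over coordinates, each
    factor being at most [1 + k%:R * l]. *)
Lemma hamming_ball_card (R : realFieldType) (n k D : nat)
    (v : {ffun 'I_n -> 'I_k}) (l : R) : 0 < l <= 1 ->
  #|[set w : {ffun 'I_n -> 'I_k} | (#|[set i | w i != v i]%SET| <= D)%N]%SET|%:R
    * l ^+ D <= (1 + k%:R * l) ^+ n.
Proof.
move=> /andP[l0 l1]; pose h (i : 'I_n) (b : 'I_k) : R := if b != v i then l else 1.
have h0 i b : 0 <= h i b by rewrite /h; case: ifP => // _; exact: ltW.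
apply: (@le_trans _ _ (\sum_(w : {ffun 'I_n -> 'I_k}) \prod_i h i (w i))).
  rewrite -sum1_card natr_sum mulr_suml.
  rewrite [leRHS](bigID (mem [set w : {ffun 'I_n -> 'I_k} |
    (#|[set i | w i != v i]%SET| <= D)%N]%SET))/=.
  rewrite ler_wpDr//; first by apply: sumr_ge0 => w _; exact: prodr_ge0.
  apply: ler_sum => w; rewrite inE => wD; rewrite mul1r.
  rewrite /h -big_mkcond/= prodr_const.
  have -> : #|(fun i => w i != v i)| = #|[set i | w i != v i]%SET|.
    by apply: eq_card => i; rewrite !inE.
  by rewrite -(subnKC wD) exprD ler_piMr// ?exprn_ge0 ?exprn_ile1// ltW.
rewrite -bigA_distr_bigA/= -[n in leRHS]card_ord -prodr_const.
apply: ler_prod => i _; rewrite sumr_ge0//= (bigD1 (v i))//= {1}/h eqxx/= lerD2l.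
apply: (@le_trans _ _ (\sum_(j < k) l)); last by rewrite sumr_const card_ord mulr_natl.
rewrite [leRHS](bigD1 (v i))//= ler_wpDl ?(ltW l0)//.
by apply: ler_sum => j jv; rewrite /h jv.
Qed.

(** Subadditivity of Shannon entropy, by Gibbs' inequality: apply [ln x <= x - 1] to the ratio of
    the product of the marginals to the joint mass. The error terms [b i * c j - a i j] sum to
    [1 - 1 = 0]. *)
Lemma eta_sum_le (R : realType) (I J : finType) (a : I -> J -> R) :
  (forall i j, 0 <= a i j) -> \sum_i \sum_j a i j = 1 ->
  \sum_i \sum_j Defs.eta (a i j) <=
    \sum_i Defs.eta (\sum_j a i j) + \sum_j Defs.eta (\sum_i a i j).
Proof.
move=> a0 a1; have etaE (t : R) : Defs.eta t = - (t * ln t).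
  by rewrite /Defs.eta; have [->|//] := eqVneq t 0; rewrite mul0r oppr0.
pose b i := \sum_j a i j; pose c j := \sum_i a i j.
have b0 i : 0 <= b i by exact: sumr_ge0.
have c0 j : 0 <= c j by exact: sumr_ge0.
have key i j : Defs.eta (a i j) <= - (a i j * ln (b i)) - a i j * ln (c j)
    + (b i * c j - a i j).
  have [aij0|] := eqVneq (a i j) 0.
    by rewrite etaE aij0 !mul0r; have := mulr_ge0 (b0 i) (c0 j); lra.
  rewrite neq_lt ltNge a0/= => aij.
  have bi : 0 < b i.
    by apply: lt_le_trans aij _; rewrite /b (bigD1 j)//= ler_wpDr// sumr_ge0.
  have cj : 0 < c j.
    by apply: lt_le_trans aij _; rewrite /c (bigD1 i)//= ler_wpDr// sumr_ge0.
  have : ln (b i * c j / a i j) <= b i * c j / a i j - 1.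
    have := @le_ln1Dx R (b i * c j / a i j - 1).
    rewrite [1 + _]addrC subrK; apply.
    by rewrite ltrBDl addrN divr_gt0// mulr_gt0.
  rewrite ln_div ?posrE ?mulr_gt0// lnM ?posrE//.
  move=> /(ler_wpM2l (a0 i j)).
  rewrite (_ : a i j * (_ / _ - 1) = b i * c j - a i j); last first.
    by field; rewrite gt_eqF.
  rewrite etaE; lra.
apply: (@le_trans _ _ (\sum_i \sum_j (- (a i j * ln (b i)) - a i j * ln (c j)
    + (b i * c j - a i j)))).
  by apply: ler_sum => i _; apply: ler_sum => j _.
have bE : \sum_i b i = 1 by [].
have cE : \sum_j c j = 1 by rewrite /c exchange_big.
under eq_bigr do rewrite !big_split/=.
rewrite !big_split/=.
have -> : \sum_i \sum_j - (a i j * ln (b i)) = \sum_i Defs.eta (b i).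
  by apply: eq_bigr => i _; rewrite sumrN -mulr_suml etaE.
have -> : \sum_i \sum_j - (a i j * ln (c j)) = \sum_j Defs.eta (c j).
  by rewrite exchange_big/=; apply: eq_bigr => j _; rewrite sumrN -mulr_suml etaE.
have -> : \sum_i \sum_j b i * c j = 1.
  by under eq_bigr do rewrite -mulr_sumr cE mulr1.
have -> : \sum_i \sum_j - a i j = - 1.
  by under eq_bigr do rewrite sumrN; rewrite sumrN a1.
by rewrite subrr addr0.
Qed.

Lemma eta_ge0 (R : realType) (t : R) : 0 <= t <= 1 -> 0 <= Defs.eta t.
Proof.
move=> /andP[t0 t1]; rewrite /Defs.eta; case: eqP => // _.
by rewrite oppr_ge0 mulr_ge0_le0// ln_le0.
Qed.

(** Markov's inequality for the information function [- ln (p w)]. Take for [G] the points of mass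
    at least [expR (- s)]: there are at most [expR s] of them, and every other point contributes at
    least [s * p w] to the entropy. *)
Lemma entropy_typical (R : realType) (W : finType) (p : W -> R) (s g : R) :
  (forall w, 0 <= p w) -> \sum_w p w = 1 -> 0 < s ->
  \sum_w Defs.eta (p w) <= g * s ->
  exists G : {set W}, #|G|%:R <= expR s /\ \sum_(w | w \notin G) p w <= g.
Proof.
move=> p0 p1 s0 Hs; exists [set w | expR (- s) <= p w]%SET; split.
  rewrite -(@ler_pM2r _ (expR (- s))) ?expR_gt0// -expRD subrr expR0 -[leRHS]p1.
  rewrite -sum1_card natr_sum mulr_suml [leRHS](bigID (mem [set w | expR (- s) <= p w]%SET))/=.
  rewrite ler_wpDr ?sumr_ge0//.
  by apply: ler_sum => w; rewrite inE mul1r.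
rewrite -(ler_pM2r s0); apply: le_trans Hs.
rewrite mulr_suml [leRHS](bigID (fun w => w \notin [set w | expR (- s) <= p w]%SET))/=.
have pw1 w : p w <= 1.
  by rewrite -p1 (bigD1 w)//= ler_wpDr// sumr_ge0.
rewrite ler_wpDr//; first by apply: sumr_ge0 => w _; rewrite eta_ge0// p0 pw1.
apply: ler_sum => w; rewrite inE -ltNge => pws.
rewrite /Defs.eta; case: eqP => [->|/eqP pn0]; first by rewrite mul0r.
have pw0 : 0 < p w by rewrite lt_neqAle eq_sym pn0 p0.
rewrite -mulrN ler_wpM2l// lerNr -[leRHS]expRK ler_ln ?posrE ?expR_gt0//; exact: ltW.
Qed.

(** Fekete's lemma; the limit is the infimum of the quotients over positive indices. *)
Lemma subadditive_cvg (R : realType) (a : nat -> R) :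
  (forall n, 0 <= a n) -> (forall m n, a (m + n)%N <= a m + a n) ->
  exists2 L : R, 0 <= L & (a n / n%:R) @[n --> \oo] --> L.
Proof.
move=> a0 aD; pose A := [set a n.+1 / n.+1%:R | n in [set: nat]].
have Alb : lbound A 0 by move=> _ [n _ <-]; rewrite divr_ge0.
have Ainf : has_inf A by split; [exists (a 1%N / 1%:R), 0%N | exists 0].
(* Used with Euclidean division of the index by [q]. The term [a 0%N] stays because subadditivity
   does not force it to vanish. *)
have amul q k r : a (k * q + r)%N <= k%:R * a q + r%:R * a 1%N + a 0%N.
  elim: k => [|k IH].
    rewrite mul0r add0r mul0n add0n; elim: r => [|r IH]; first by rewrite mul0r add0r.
    by have := aD r 1%N; rewrite addn1 -natr1; lra.
  by rewrite mulSn -addnA (le_trans (aD _ _))// -natr1; lra.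
exists (inf A); first by apply: lb_le_inf => //; exists (a 1%N / 1%:R), 0%N.
apply/cvgrPdist_le => e; change (Real.sort R) in (type of e) => e0.
have [_ [q _ <-] Aq] := @inf_adherent _ A (e / 2) ltac:(lra) Ainf.
(* [B] bounds the contribution of every remainder modulo [q.+1], uniformly in [n], so it is
   negligible after division by [n]. *)
pose B := q.+1%:R * a 1%N + a 0%N.
have B0 : 0 <= B by rewrite addr_ge0// mulr_ge0.
near=> n.
have n0 : (0 < n)%N by near: n; exact: nbhs_infty_gt.
have n0R : 0 < n%:R :> R by rewrite ltr0n.
rewrite ler_distlC; apply/andP; split.
  rewrite lerBlDr ler_wpDr ?(ltW e0)//; apply: ge_inf; first by exists 0.
  by exists n.-1 => //; rewrite prednK.
have Bn : B <= e / 2 * n%:R.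
  rewrite -ler_pdivrMl ?divr_gt0//; near: n; exact: nbhs_infty_ger.
rewrite ler_pdivrMr// {1}(divn_eq n q.+1) (le_trans (amul _ _ _))//.
have rq : (n %% q.+1)%:R * a 1%N <= q.+1%:R * a 1%N.
  by rewrite ler_wpM2r// ler_nat ltnW// ltn_pmod.
have kq : (n %/ q.+1)%:R * a q.+1 <= n%:R * (a q.+1 / q.+1%:R).
  rewrite [leLHS](_ : _ = ((n %/ q.+1)%:R * q.+1%:R) * (a q.+1 / q.+1%:R)).
    by rewrite ler_wpM2r ?divr_ge0// -natrM ler_nat leq_trunc_div.
  by field; rewrite gt_eqF// ltr0n.
have := ler_wpM2l (ltW n0R) (ltW Aq); move: Bn; rewrite /B.
move: kq rq; set x := a q.+1 / _; set y := q.+1%:R * _; set z := _%:R * a q.+1; set t := _%:R * a 1%N.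
rewrite mulrDr mulrDl; move: (n%:R * x) => u k1 k2 k3 k4.
rewrite [_ * n%:R]mulrC [e * _](_ : _ = e / 2 * n%:R + n%:R * (e / 2)); [lra|field].
Unshelve. all: by end_near. Qed.

(** * Itineraries and typical words *)

Section fibers.
Context {d : measure_display} {Z : measurableType d} {R : realType}.
Context {I : finType} (phi : Z -> I).
Hypothesis mphi : forall i, measurable (phi @^-1` [set i]).

Lemma measurable_fibers (H : pred I) : measurable [set z | H (phi z)].
Proof.
rewrite (_ : [set z | _] = \bigcup_(i in [set i | H i]) (phi @^-1` [set i])).
  by apply: fin_bigcup_measurable => // i _; exact: mphi.
by apply/seteqP; split => [z Hz|z [i /= Hi ->]//]; exists (phi z).
Qed.

Lemma measure_fibers (m : {finite_measure set Z -> \bar R}) (H : pred I) :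
  fine (m [set z | H (phi z)]) = \sum_(i | H i) fine (m (phi @^-1` [set i])).
Proof.
rewrite -big_enum/= (_ : [set z | _] = [set z | phi z \in enum H]); last first.
  by apply/seteqP; split => z /=; rewrite mem_enum.
elim: (enum H) (enum_uniq H) => [_|i s IH /= /andP[si us]].
  rewrite big_nil (_ : [set z | _] = set0) ?measure0//.
  by apply/seteqP; split => // z; rewrite /= in_nil.
rewrite big_cons -IH//.
rewrite (_ : [set z | _] = (phi @^-1` [set i]) `|` [set z | phi z \in s]).
  have ms : measurable [set z | phi z \in s] by exact: (measurable_fibers (mem s)).
  have mi := mphi i.
  rewrite measureU// ?fineD ?fin_num_measure//.
  by apply/seteqP; split => // z [/= -> is_]; rewrite is_ in si.
apply/seteqP; split => z /=; rewrite in_cons.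
  by move=> /orP[/eqP|]; [left|right].
by move=> [->|->]; rewrite ?eqxx ?orbT.
Qed.

End fibers.

(** The [n]-name of [x] for the partition into fibres of [phi]. As a function with finitely many
    values it lets the masses of join cells be summed by [measure_fibers]. *)
Definition itinerary (X : Type) (k : nat) (T : X -> X) (phi : X -> 'I_k)
    (n : nat) (x : X) : {ffun 'I_n -> 'I_k} := [ffun i : 'I_n => phi (iter i T x)].

Definition splice (k m n : nat) (u : {ffun 'I_m -> 'I_k}) (v : {ffun 'I_n -> 'I_k}) :
    {ffun 'I_(m + n) -> 'I_k} :=
  [ffun i : 'I_(m + n) => match fintype.split i with inl a => u a | inr b => v b end].

Lemma splice_bij (k m n : nat) :
  bijective (fun uv : {ffun 'I_m -> 'I_k} * {ffun 'I_n -> 'I_k} => splice uv.1 uv.2).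
Proof.
exists (fun w : {ffun 'I_(m + n) -> 'I_k} => ([ffun i => w (lshift n i)], [ffun i => w (rshift m i)])).
  move=> [u v] /=; congr pair; apply/ffunP => i; rewrite !ffunE.
    by rewrite (unsplitK (inl i)).
  by rewrite (unsplitK (inr i)).
move=> w; apply/ffunP => i; rewrite !ffunE.
by case: split_ordP => j ->; rewrite ffunE.
Qed.

Lemma itineraryD (X : Type) (k m n : nat) (T : X -> X) (phi : X -> 'I_k) (x : X) :
  itinerary T phi (m + n) x = splice (itinerary T phi m x) (itinerary T phi n (iter m T x)).
Proof.
apply/ffunP => i; rewrite !ffunE; case: split_ordP => j ->; rewrite ffunE//=.
by rewrite addnC iterD.
Qed.

Section zero_entropy.
Context {d : measure_display} {X : measurableType d} {R : realType}.
Variables (mu : probability X R) (T : X -> X).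
Hypothesis mT : measurable_fun setT T.
Hypothesis muT : forall A, measurable A -> mu (T @^-1` A) = mu A.

Lemma measurable_iter n A : measurable A -> measurable (iter n T @^-1` A).
Proof.
move=> mA; elim: n => [//|n IH].
rewrite (_ : _ @^-1` _ = T @^-1` (iter n T @^-1` A)).
  by rewrite -[X in measurable X]setTI; exact: mT.
by apply/seteqP; split => x /=; rewrite -iterSr.
Qed.

Lemma measure_iter n A : measurable A -> mu (iter n T @^-1` A) = mu A.
Proof.
move=> mA; elim: n => [//|n IH].
rewrite (_ : _ @^-1` _ = T @^-1` (iter n T @^-1` A)).
  by rewrite muT//; exact: measurable_iter.
by apply/seteqP; split => x /=; rewrite -iterSr.
Qed.

Variables (k : nat) (phi : X -> 'I_k).
Hypothesis mphi : forall i, measurable (phi @^-1` [set i]).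

Let P (i : 'I_k) : set X := phi @^-1` [set i].

Lemma itinerary_fiber n (w : {ffun 'I_n -> 'I_k}) :
  itinerary T phi n @^-1` [set w] = join_cell T P w.
Proof.
apply/seteqP; split => [x /= <- i _|x Pw /=]; first by rewrite /P/= ffunE.
by apply/ffunP => i; rewrite ffunE; exact: Pw.
Qed.

Lemma measurable_itinerary n (w : {ffun 'I_n -> 'I_k}) :
  measurable (itinerary T phi n @^-1` [set w]).
Proof.
rewrite itinerary_fiber; apply: fin_bigcap_measurable => // i _.
by apply: measurable_iter; exact: mphi.
Qed.

Lemma join_entropyE n : join_entropy mu T P n =
  \sum_w Defs.eta (fine (mu (itinerary T phi n @^-1` [set w]))).
Proof. by apply: eq_bigr => w _; rewrite itinerary_fiber. Qed.

Lemma sum_itinerary n :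
  \sum_w fine (mu (itinerary T phi n @^-1` [set w])) = 1.
Proof.
rewrite -(measure_fibers (@measurable_itinerary n) mu predT)/=.
by rewrite (_ : [set _ | _] = setT) ?probability_setT//; apply/seteqP.
Qed.

Lemma join_entropy_ge0 n : 0 <= join_entropy mu T P n.
Proof.
rewrite join_entropyE; apply: sumr_ge0 => w _; apply: eta_ge0.
rewrite fine_ge0//= -[leRHS](sum_itinerary n) (bigD1 w)//= ler_wpDr//.
by apply: sumr_ge0 => v _; exact: fine_ge0.
Qed.

(** The first [m] letters and the next [n] letters have a joint law whose second marginal is, by
    invariance of [mu], the law of [n]-names; [eta_sum_le] applies to this joint law. *)
Lemma join_entropyD m n :
  join_entropy mu T P (m + n)%N <= join_entropy mu T P m + join_entropy mu T P n.
Proof.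
pose psi x := (itinerary T phi m x, itinerary T phi n (iter m T x)).
have psiE u v : psi @^-1` [set (u, v)] = (itinerary T phi m @^-1` [set u])
    `&` (iter m T @^-1` (itinerary T phi n @^-1` [set v])).
  by apply/seteqP; split => x; rewrite /psi/= => -[-> ->].
have mpsi uv : measurable (psi @^-1` [set uv]).
  case: uv => u v; rewrite psiE; apply: measurableI; first exact: measurable_itinerary.
  by apply: measurable_iter; exact: measurable_itinerary.
pose a u v := fine (mu (psi @^-1` [set (u, v)])).
have aE : join_entropy mu T P (m + n) = \sum_u \sum_v Defs.eta (a u v).
  rewrite join_entropyE pair_big/= (reindex _ (onW_bij _ (splice_bij k m n)))/=.
  apply: eq_bigr => -[u v] _ /=; congr (Defs.eta (fine (mu _))).
  apply/seteqP; split => x /=.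
    rewrite itineraryD => H; apply: (bij_inj (splice_bij k m n)) => /=; exact: H.
  by rewrite itineraryD => -[-> ->].
have au u : \sum_v a u v = fine (mu (itinerary T phi m @^-1` [set u])).
  transitivity (\sum_(uv | uv.1 == u) fine (mu (psi @^-1` [set uv]))).
    rewrite -(big_pred1_eq +%R u (fun u => \sum_v a u v)) pair_big/=.
    by apply: eq_big => [[u' v]|[u' v] //]; rewrite /= andbT.
  rewrite -(measure_fibers mpsi mu (fun uv => uv.1 == u)); congr (fine (mu _)).
  by apply/seteqP; split => x /= /eqP.
have av v : \sum_u a u v = fine (mu (itinerary T phi n @^-1` [set v])).
  rewrite -(measure_iter m (measurable_itinerary v)).
  transitivity (\sum_(uv | uv.2 == v) fine (mu (psi @^-1` [set uv]))).
    rewrite (eq_bigr (fun u => \sum_(v' | v' == v) a u v')) => [|u _]; last first.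
      by rewrite big_pred1_eq.
    by rewrite pair_big/=; apply: eq_bigr => -[].
  rewrite -(measure_fibers mpsi mu (fun uv => uv.2 == v)); congr (fine (mu _)).
  by apply/seteqP; split => x /= /eqP.
rewrite aE !join_entropyE.
under [X in _ <= X + _]eq_bigr do rewrite -au.
under [X in _ <= _ + X]eq_bigr do rewrite -av.
apply: eta_sum_le; first by move=> u v; exact: fine_ge0.
by under eq_bigr do rewrite au; exact: sum_itinerary.
Qed.

Lemma zero_entropy_typical (s g : R) : ms_entropy mu T = 0%E -> 0 < s -> 0 < g ->
  \forall n \near \oo, exists G : {set {ffun 'I_n -> 'I_k}},
    #|G|%:R <= expR (s * n%:R) /\
    \sum_(w | w \notin G) fine (mu (itinerary T phi n @^-1` [set w])) <= g.
Proof.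
move=> h0 s0 g0.
have [L L0 HL] := subadditive_cvg join_entropy_ge0 join_entropyD.
(* Since convergence is already known, [limn] in [ms_entropy_part] is the true limit [L], hence a
   member of the set whose supremum is zero. *)
have L_le0 : L <= 0.
  rewrite -lee_fin; apply: (@le_trans _ _ (ms_entropy mu T)); last by rewrite h0.
  apply: ereal_sup_ubound; exists k, P; split; last first.
    by rewrite /ms_entropy_part (cvg_lim _ HL).
  split; first exact: mphi.
  - by move=> i j ij; apply/seteqP; split => // x; rewrite /P/= => -[-> /eqP]; rewrite (negbTE ij).
  - by apply/seteqP; split => // x _; exists (phi x).
have {L L0 L_le0} HL : join_entropy mu T P n / n%:R @[n --> \oo] --> (0 : R).
  by rewrite (_ : 0 = L)//; apply/le_anti; rewrite L0 L_le0.
(* With threshold [g * s] the entropy of [n]-names is at most [g * (s * n%:R)], the form that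
   [entropy_typical] takes at rate [s * n%:R]. *)
have gs0 : 0 < g * s by rewrite mulr_gt0.
move/cvgrPdist_le : HL => /(_ _ gs0) HL.
near=> n.
have n0 : 0 < n%:R :> R by rewrite ltr0n; near: n; exact: nbhs_infty_gt.
have Hn : join_entropy mu T P n <= g * (s * n%:R).
  rewrite mulrA -ler_pdivrMr//; apply: le_trans (ler_norm _) _.
  by rewrite -normrN -[- _]add0r; near: n.
apply: entropy_typical; first by move=> w; exact: fine_ge0.
- exact: sum_itinerary.
- exact: mulr_gt0.
- by rewrite -join_entropyE.
Unshelve. all: by end_near. Qed.

End zero_entropy.

(** * Counting words for the lens *)

Section lens_coupling.
Context {d : measure_display} {X : measurableType d} {R : realType}.
Variables (mu : probability X R) (T : X -> X).
Hypothesis mT : measurable_fun setT T.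
Hypothesis muT : forall A, measurable A -> mu (T @^-1` A) = mu A.

Lemma coupling_pushforward d' (Y : measurableType d') (rho : probability Y R)
    (f : Y -> X * X) : measurable_fun setT f ->
  (forall A, measurable A -> rho (f @^-1` (A `*` setT)) = mu A /\
     rho (f @^-1` (setT `*` A)) = mu A) ->
  coupling mu (pushforward rho f).
Proof.
move=> mf Hf; pose F : {mfun Y >-> (X * X)%type} := mfun_Sub (mem_set mf).
exists (distribution rho F); split; first by [].
move=> A mA; exact: Hf.
Qed.

(** Witnessed by the diagonal coupling. It supplies default indices in the covering argument and
    shows that a cover has at least one member. *)
Lemma coupling_nonempty : exists m, coupling mu m.
Proof.
exists (pushforward mu (fun x => (x, x))); apply: coupling_pushforward.
  exact: measurable_fun_pair.
by move=> A mA; split; congr (mu _); apply/seteqP; split => x //= [].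
Qed.

Lemma coupling_lens m : coupling mu m -> coupling mu (lens T m).
Proof.
move=> [rho [<- Hrho]]; apply: coupling_pushforward.
  by apply: measurable_fun_pair; apply: measurableT_comp.
have mTA A : measurable A -> measurable (T @^-1` A).
  by move=> mA; rewrite -[X in measurable X]setTI; exact: mT.
by move=> A mA; have [] := Hrho _ (mTA _ mA); rewrite muT.
Qed.

Lemma coupling_iter_lens m i : coupling mu m -> coupling mu (iter i (lens T) m).
Proof. by move=> cm; elim: i => [//|i IH] /=; exact: coupling_lens. Qed.

Lemma iter_lensE (m : set (X * X) -> \bar R) i (A B : set X) :
  iter i (lens T) m (A `*` B) = m ((iter i T @^-1` A) `*` (iter i T @^-1` B)).
Proof.
elim: i A B => [//|i IH] A B.
rewrite iterS {1}/lens {1}/pushforward (_ : _ @^-1` _ = (T @^-1` A) `*` (T @^-1` B)).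
  by rewrite IH; congr (m (_ `*` _)); apply/seteqP; split => x /=; rewrite -iterS.
by apply/seteqP; split => -[x y].
Qed.

End lens_coupling.

Lemma cover_number_le (Y : Type) (K : set Y) (f : Y -> Y) (k : nat)
    (U : 'I_k -> set Y) (n : nat) (S : {set {ffun 'I_n -> 'I_k}}) :
  K `<=` \bigcup_(w in [set w | w \in S]) join_cell f U w ->
  (cover_number K f U n <= #|S|)%N.
Proof.
(* The minimum is a fold over the list of all families of words; induction on that list reaches
   [S]. *)
move=> KS; rewrite /cover_number; have : S \in index_enum _ by exact: mem_index_enum.
elim: index_enum => // S' s IH; rewrite in_cons big_cons => /orP[/eqP <-|/IH {}IH].
  by case: ifPn => [_|/negP[]]; [exact: geq_minl|exact/asboolP].
by case: ifP => // _; rewrite geq_min IH orbT.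
Qed.

Lemma card_bigcup_le (I T : finType) (F : I -> {set T}) :
  (#|(\bigcup_i F i)%SET| <= \sum_i #|F i|)%N.
Proof.
elim/big_ind2 : _ => [|A m B n Am Bn|//]; first by rewrite cards0.
by rewrite (leq_trans (leq_card_setU _ _))// leq_add.
Qed.

Section covering.
Context {d : measure_display} {X : measurableType d} {R : realType}.
Variables (mu : probability X R) (T : X -> X).
Hypothesis mT : measurable_fun setT T.
Hypothesis muT : forall A, measurable A -> mu (T @^-1` A) = mu A.
Variables (k : nat) (U : 'I_k -> set (set (X * X) -> \bar R)).
Variables (J : nat) (A B : 'I_J -> set X) (e : R).
Hypothesis e0 : 0 < e.
Hypothesis lebesgue_number : forall m, coupling mu m -> exists i, forall m',
  coupling mu m' ->
  (forall j, `|fine (m' (A j `*` B j)) - fine (m (A j `*` B j))| < e) -> U i m'.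
(** Each [A j] and [B j] is a union of fibres of [phi], so visits of an orbit to these sets can be
    read off its name through [alpha] and [beta]. *)
Variables (K : nat) (phi : X -> 'I_K) (alpha beta : 'I_J -> pred 'I_K).
Hypothesis mphi : forall i, measurable (phi @^-1` [set i]).
Hypothesis Aalpha : forall j, A j = [set x | alpha j (phi x)].
Hypothesis Bbeta : forall j, B j = [set x | beta j (phi x)].

Local Notation word n := {ffun 'I_n -> 'I_K}.

(** The 0/1 vector of a pair of names, indexed by a time [c.1] and a rectangle [c.2]. *)
Let hit n (uv : word n * word n) (c : 'I_n * 'I_J) : R :=
  (alpha c.2 (uv.1 c.1) && beta c.2 (uv.2 c.1))%:R.

Let hit01 n (uv : word n * word n) c : 0 <= hit uv c <= 1.
Proof. by rewrite /hit; case: (alpha _ _ && _); rewrite ?lexx ?ler01. Qed.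

Let names n (p : X * X) := (itinerary T phi n p.1, itinerary T phi n p.2).

Let mnames n uv : measurable (names n @^-1` [set uv]).
Proof.
case: uv => u v; rewrite (_ : _ @^-1` _ =
    (itinerary T phi n @^-1` [set u]) `*` (itinerary T phi n @^-1` [set v])).
  by apply: measurableX; exact: measurable_itinerary.
by apply/seteqP; split => -[x y]; rewrite /names/= => -[-> ->].
Qed.

(* Atypical words are redirected to [u0], which moves every coordinate by at most
   [e / 4]; the conclusion bounds the number of badly approximated times. *)
Lemma coupling_approx n (G : {set word n}) (u0 : word n) (M : nat)
    (m : set (X * X) -> \bar R) :
  u0 \in G ->
  \sum_(w | w \notin G) fine (mu (itinerary T phi n @^-1` [set w])) <= e / 8 ->
  coupling mu m ->
  exists t : M.-tuple {z | z \in finset.setX G G},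
    M%:R * e ^+ 2 * #|[set i | [exists j, e / 2 * M%:R <=
      `|\sum_(z <- t) hit (val z) (i, j)
        - M%:R * fine (iter i (lens T) m (A j `*` B j))|]]%SET|%:R
    <= 16 * (n * J)%:R.
Proof.
move=> Gu0 Gsmall [rho [<- Hrho]].
pose a uv := fine (rho (names n @^-1` [set uv])).
have a0 uv : 0 <= a uv by exact: fine_ge0.
have a1 : \sum_uv a uv = 1.
  rewrite -(measure_fibers (@mnames n) rho predT)/=.
  by rewrite (_ : [set _ | _] = setT) ?probability_setT//; apply/seteqP.
pose r (u : word n) := if u \in G then u else u0.
have rG u : r u \in G by rewrite /r; case: ifP.
have rGG (uv : word n * word n) : (r uv.1, r uv.2) \in finset.setX G G.
  by rewrite finset.in_setX !rG.
pose rr uv : {z | z \in finset.setX G G} := exist (fun z => z \in finset.setX G G) (r uv.1, r uv.2) (rGG uv).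
pose p c := fine (iter (c.1 : 'I_n) (lens T) rho (A c.2 `*` B c.2)).
pose p' c := \sum_uv a uv * hit (val (rr uv)) c.
(* The orbit of the coupling, read on the rectangles, is the average of the vectors [hit uv] under
   the law [a] of pairs of names. *)
have pE c : p c = \sum_uv a uv * hit uv c.
  rewrite /p iter_lensE; transitivity (fine (rho [set z |
      (fun uv : word n * word n => alpha c.2 (uv.1 c.1) && beta c.2 (uv.2 c.1)) (names n z)])).
    congr (fine (rho _)); apply/seteqP; rewrite Aalpha Bbeta.
    split => -[x y]; rewrite /names/= !ffunE; first by move=> [-> ->].
    by move=> /andP[-> ->].
  rewrite (measure_fibers (@mnames n) rho (fun uv : word n * word n =>
    alpha c.2 (uv.1 c.1) && beta c.2 (uv.2 c.1))) big_mkcond/=; apply: eq_bigr => uv _.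
  by rewrite /hit; case: ifP; rewrite ?mulr1 ?mulr0.
(* Both marginals of [rho] are [mu], so each of the two names is atypical with probability at most
   [e / 8], whatever the coupling. *)
have pp' c : `|p' c - p c| <= e / 4.
  have mG := measurable_fibers (measurable_itinerary mT mphi (n := n))
    (fun u => u \notin G).
  have muG : fine (mu [set x | itinerary T phi n x \notin G]) <= e / 8.
    by rewrite (measure_fibers (measurable_itinerary mT mphi (n := n)) mu
      (fun u => u \notin G)).
  have [rho1 rho2] := Hrho _ mG.
  have aG1 : \sum_(uv | uv.1 \notin G) a uv <= e / 8.
    rewrite -(measure_fibers (@mnames n) rho (fun uv => uv.1 \notin G)).
    rewrite -rho1 in muG; apply: le_trans muG.
    rewrite le_eqVlt; apply/orP; left; apply/eqP; congr (fine (rho _)).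
    by apply/seteqP; split => -[x y] //= [].
  have aG2 : \sum_(uv | uv.2 \notin G) a uv <= e / 8.
    rewrite -(measure_fibers (@mnames n) rho (fun uv => uv.2 \notin G)).
    rewrite -rho2 in muG; apply: le_trans muG.
    rewrite le_eqVlt; apply/orP; left; apply/eqP; congr (fine (rho _)).
    by apply/seteqP; split => -[x y] //= [].
  rewrite pE /p' -sumrB; apply: le_trans (ler_norm_sum _ _ _) _.
  rewrite (_ : e / 4 = e / 8 + e / 8); last by field.
  apply: le_trans (lerD aG1 aG2); rewrite [X in _ <= X + _]big_mkcond.
  rewrite [X in _ <= _ + X]big_mkcond -big_split/=; apply: ler_sum => uv _.
  rewrite -mulrBr normrM (ger0_norm (a0 _)).
  have h1 : `|hit (val (rr uv)) c - hit uv c| <= 1.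
    have := hit01 (val (rr uv)) c; have := hit01 uv c.
    by move=> /andP[? ?] /andP[? ?]; rewrite ler_norml; lra.
  have h2 := ler_wpM2l (a0 uv) h1.
  case: ifPn => [_|]; first by rewrite (le_trans h2)// mulr1 ler_wpDr//; case: ifP.
  rewrite negbK => u1; case: ifPn => [_|]; first by rewrite add0r (le_trans h2)// mulr1.
  rewrite negbK => u2; rewrite /rr/= /r u1 u2 -surjective_pairing.
  by rewrite subrr normr0 mulr0 addr0.
have [t] := approx_caratheodory M a0 a1 (fun uv c => hit01 (val (rr uv)) c).
rewrite card_prod !card_ord -/p' => Ht.
exists [tuple of map rr t]; set bad := [set i | _]%SET.
have [->|M0] := eqVneq M 0%N; first by rewrite !mul0r mulr_ge0.
have M0R : 0 < M%:R :> R by rewrite ltr0n lt0n.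
(* At a bad time some rectangle deviates by at least [M * e / 2] from the true value, hence by
   [M * e / 4] from the redirected one. Each bad time thus takes [(M * e / 4) ^ 2] out of a total
   squared error of at most [M * n * J]; this is the origin of the factor 16. *)
suff : #|bad|%:R * (M%:R * e / 4) ^+ 2 <= M%:R * (n * J)%:R.
  rewrite -(ler_pM2l (_ : 0 < 16 / M%:R))//; last by rewrite divr_gt0.
  rewrite (_ : _ * (M%:R * _) = 16 * (n * J)%:R); last by field; rewrite gt_eqF.
  by rewrite (_ : _ / _ * _ = M%:R * e ^+ 2 * #|bad|%:R)//; field; rewrite gt_eqF.
apply: le_trans Ht.
rewrite (_ : index_enum _ = index_enum ('I_n * 'I_J)%type)//.
rewrite -(pair_bigA _ (fun i j => (\sum_(uv <- t) hit (val (rr uv)) (i, j)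
   - M%:R * p' (i, j)) ^+ 2))/=.
rewrite (bigID (mem bad))/= ler_wpDr//.
  by apply: sumr_ge0 => i _; apply: sumr_ge0 => j _; exact: sqr_ge0.
rewrite -sum1_card natr_sum mulr_suml; apply: ler_sum => i.
rewrite inE => /existsP[j Hj]; rewrite mul1r (bigD1 j)//= ler_wpDr//.
  by apply: sumr_ge0 => ? _; exact: sqr_ge0.
rewrite -[leRHS]real_normK ?num_real// ler_pXn2r// ?nnegrE ?divr_ge0// ?mulr_ge0// ?(ltW e0)//.
rewrite big_map in Hj.
have := pp' (i, j); rewrite -(ler_pM2l M0R) -[M%:R in X in X <= _ -> _](ger0_norm (ler0n _ M)).
rewrite -normrM; move: Hj; rewrite -[fine _]/(p (i, j)).
set S := \sum_(_ <- _) _; move: (p _) (p' _) => q q' h1 h2.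
have := ler_normD (S - M%:R * q') (M%:R * (q' - q)).
rewrite (_ : S - M%:R * q' + M%:R * (q' - q) = S - M%:R * q); last by ring.
by move: h1 h2; lra.
Qed.

(** An [M]-tuple of pairs of typical names gives an averaged vector, which selects a member of the
    cover at each time and so a word [v t]. By [coupling_approx] every coupling follows some word
    within Hamming distance [D] of some [v t]; it remains to count tuples and balls. *)
Lemma cover_number_bound n (G : {set word n}) (u0 : word n) (M D : nat) (l : R) :
  u0 \in G ->
  \sum_(w | w \notin G) fine (mu (itinerary T phi n @^-1` [set w])) <= e / 8 ->
  (0 < M)%N -> 0 < l <= 1 ->
  16 * (n * J)%:R < M%:R * e ^+ 2 * D.+1%:R ->
  (cover_number (coupling mu) (lens T) U n)%:R * l ^+ D
    <= (#|G| * #|G|)%:R ^+ M * (1 + k%:R * l) ^+ n.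
Proof.
move=> Gu0 Gsmall M0 l01 HD; have M0R : 0 < M%:R :> R by rewrite ltr0n.
(* Two couplings within [e / 2] of the same vector are within [e] of each other, so one member of
   the cover contains all couplings near that vector. If there are none, any index serves. *)
have [s Hs] : {s : ('I_J -> R) -> 'I_k | forall y m, coupling mu m ->
    (forall j, `|fine (m (A j `*` B j)) - y j| < e / 2) -> U (s y) m}.
  suff /choice[s Hs] : forall y : 'I_J -> R, exists i, forall m, coupling mu m ->
      (forall j, `|fine (m (A j `*` B j)) - y j| < e / 2) -> U i m by exists s.
  move=> y; have [[m0 [cm0 Hm0]]|] := pselect (exists m, coupling mu m /\
      forall j, `|fine (m (A j `*` B j)) - y j| < e / 2).
    have [i Hi] := lebesgue_number cm0; exists i => m cm Hm; apply: Hi => // j.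
    by move: (Hm j) (Hm0 j); rewrite !ltr_distl; lra.
  have [m1 /lebesgue_number[i _]] := coupling_nonempty mu.
  by move=> nex; exists i => m cm Hm; exfalso; apply: nex; exists m.
pose y (t : M.-tuple {z | z \in finset.setX G G}) i j :=
  (\sum_(z <- t) hit (val z) (i, j)) / M%:R.
pose v t : {ffun 'I_n -> 'I_k} := [ffun i => s (y t i)].
pose ball t := [set w : {ffun 'I_n -> 'I_k} | (#|[set i | w i != v t i]%SET| <= D)%N]%SET.
have cover : coupling mu `<=` \bigcup_(w in [set w | w \in (\bigcup_t ball t)%SET])
    join_cell (lens T) U w.
  move=> m cm; have [t Ht] := coupling_approx M Gu0 Gsmall cm.
  set bad := [set i | _]%SET in Ht.
  have badD : (#|bad| <= D)%N.
    rewrite -ltnS -(ltr_nat R) -(ltr_pM2l (_ : 0 < M%:R * e ^+ 2)).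
      exact: le_lt_trans Ht HD.
    by rewrite mulr_gt0// exprn_gt0.
  have [idx Hidx] : { idx : 'I_n -> 'I_k | forall i : 'I_n, U (idx i) (iter i (lens T) m)}.
    suff /choice[idx Hidx] : forall i : 'I_n, exists b, U b (iter i (lens T) m) by exists idx.
    move=> i; have cmi := coupling_iter_lens mT muT i cm.
    have [b Hb] := lebesgue_number cmi; exists b; apply: Hb => // j.
    by rewrite subrr normr0.
  (* At good times the averaged vector dictates the letter; at the at most [D] bad times the letter
     is taken from the coupling itself. *)
  exists [ffun i => if i \in bad then idx i else v t i] => /=.
    apply/finset.bigcupP; exists t => //; rewrite inE.
    apply: leq_trans badD; apply: subset_leq_card; apply/fintype.subsetP => i.
    by rewrite inE ffunE; case: ifP => // _; rewrite eqxx.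
  move=> i _; rewrite /= ffunE; case: ifPn => [_|]; first exact: Hidx.
  rewrite inE negb_exists => /forallP good; rewrite ffunE.
  apply: Hs => [|j]; first exact: coupling_iter_lens.
  have gj := good j; rewrite -ltNge in gj.
  rewrite -(ltr_pM2r M0R) -[X in _ * X < _]ger0_norm ?ler0n// -normrM mulrBl.
  by rewrite divfK ?gt_eqF// distrC [_ * M%:R]mulrC.
apply: (@le_trans _ _ ((\sum_t #|ball t|)%:R * l ^+ D)).
  rewrite ler_wpM2r ?exprn_ge0//; first by case/andP: l01 => /ltW.
  by rewrite ler_nat (leq_trans (cover_number_le cover))// card_bigcup_le.
rewrite natr_sum mulr_suml.
apply: (@le_trans _ _ (\sum_(t : M.-tuple {z | z \in finset.setX G G})
    (1 + k%:R * l) ^+ n)).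
  by apply: ler_sum => t _; exact: hamming_ball_card.
by rewrite sumr_const card_tuple card_sig cardsX -[leLHS]mulr_natl natrX.
Qed.

(** The logarithm of [cover_number_bound] has three terms, for the tuples, the ball weights and the
    radius, and each is given [eps / 3] per unit of time. First [l] is fixed, then [M], then the
    exponential rate for typical names; none depends on [n]. *)
Lemma cover_number_growth (eps : R) : ms_entropy mu T = 0%E -> 0 < eps ->
  \forall n \near \oo,
    ln ((cover_number (coupling mu) (lens T) U n)%:R : R) <= eps * n%:R.
Proof.
move=> h0 eps0.
have k0 : 0 < k%:R :> R.
  by rewrite ltr0n; have [m /lebesgue_number[[? +] _]] := coupling_nonempty mu; case: k.
(* This value satisfies both [l <= 1] and [k * l <= eps / 3]. *)
pose l : R := eps / (3 * k%:R + eps).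
have den0 : 0 < 3 * k%:R + eps by lra.
have l01 : 0 < l <= 1 by rewrite divr_gt0// ler_pdivrMr// mul1r; lra.
have kl : k%:R * l <= eps / 3.
  by rewrite mulrA ler_pdivrMr//; nra.
have lnl : 0 <= - ln l by rewrite oppr_ge0 ln_le0//; case/andP: l01.
have e2 : 0 < e ^+ 2 by rewrite exprn_gt0.
(* The radius will be about [16 * n * J / (M * e ^ 2)], and each unit of it costs [- ln l]. *)
have [M M0 HM] : exists2 M, (0 < M)%N & 16 * J%:R * (- ln l) <= eps / 3 * (M%:R * e ^+ 2).
  pose z := 48 * J%:R * (- ln l) / (e ^+ 2 * eps).
  exists (Num.bound z).+1 => //.
  have : z <= (Num.bound z).+1%:R.
    apply: (@le_trans _ _ (Num.bound z)%:R); last by rewrite ler_nat.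
    by apply/ltW/archi_boundP; rewrite divr_ge0 ?mulr_ge0// ltW.
  by rewrite ler_pdivrMr ?mulr_gt0//; lra.
have M0R : 0 < M%:R :> R by rewrite ltr0n.
(* A tuple consists of [2 * M] names, so this rate makes the tuples cost [eps / 3]. *)
have s0 : 0 < eps / (6 * M%:R) by rewrite divr_gt0// mulr_gt0.
(* Below [e / 8] for the approximation, and below 1 so that the typical set cannot be empty. *)
pose g : R := e / (8 + e).
have g0 : 0 < g by rewrite divr_gt0// addr_gt0.
have g1 : g < 1 by rewrite ltr_pdivrMr ?addr_gt0// mul1r; lra.
have ge : g <= e / 8.
  by rewrite ler_pdivrMr ?addr_gt0//; move: e2; rewrite expr2; lra.
near=> n.
have n0 : 0 < n%:R :> R by rewrite ltr0n; near: n; exact: nbhs_infty_gt.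
have [G [cardG Gg]] : exists G : {set word n},
    #|G|%:R <= expR (eps / (6 * M%:R) * n%:R) /\
    \sum_(w | w \notin G) fine (mu (itinerary T phi n @^-1` [set w])) <= g.
  by near: n; exact: zero_entropy_typical.
have [u0 Gu0] : exists u0, u0 \in G.
  apply/set0Pn; apply: contraTneq Gg => ->; rewrite -ltNge.
  by rewrite (eq_bigl xpredT) ?sum_itinerary// => w; rewrite finset.in_set0.
(* The value 0 is settled by the convention [ln 0 = 0]; afterwards logarithms may be compared. *)
have [->|N0] := eqVneq (cover_number (coupling mu) (lens T) U n) 0%N.
  by rewrite ln0// mulr_ge0// ltW.
have {N0}N0 : 0 < (cover_number (coupling mu) (lens T) U n)%:R :> R.
  by rewrite ltr0n lt0n.
pose q := 16 * (n * J)%:R / (M%:R * e ^+ 2).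
have q0 : 0 <= q by rewrite divr_ge0 ?mulr_ge0// ltW.
have Me2 : 0 < M%:R * e ^+ 2 by rewrite mulr_gt0.
have HD : 16 * (n * J)%:R < M%:R * e ^+ 2 * (Num.truncn q).+1%:R.
  by rewrite [ltRHS]mulrC -ltr_pdivrMr// truncnS_gt.
have := cover_number_bound Gu0 (le_trans Gg ge) M0 l01 HD.
have G0 : (0 < #|G|)%N by apply/card_gt0P; exists u0.
have l0 : 0 < l by case/andP: l01.
have kl0 : 0 < 1 + k%:R * l by rewrite addr_gt0// mulr_gt0.
have G0R : 0 < #|G|%:R :> R by rewrite ltr0n.
have GG0 : 0 < (#|G| * #|G|)%:R :> R by rewrite natrM mulr_gt0.
rewrite -ler_ln ?posrE; [|by rewrite mulr_gt0// exprn_gt0..].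
rewrite lnM ?posrE ?exprn_gt0// lnM ?posrE ?exprn_gt0//.
rewrite !lnXn// natrM lnM ?posrE//.
have lnG : ln (#|G|%:R : R) <= eps / (6 * M%:R) * n%:R.
  by rewrite -[leRHS]expRK ler_ln ?posrE ?ltr0n ?expR_gt0.
have h1 : (ln (#|G|%:R : R) + ln #|G|%:R) *+ M <= eps / 3 * n%:R.
  rewrite -[leLHS]mulr_natl (_ : eps / 3 * n%:R =
    M%:R * (eps / (6 * M%:R) * n%:R + eps / (6 * M%:R) * n%:R)).
    by rewrite ler_wpM2l// lerD.
  by field; rewrite gt_eqF.
have h2 : ln (1 + k%:R * l) *+ n <= eps / 3 * n%:R.
  rewrite -[leLHS]mulr_natr ler_wpM2r// (le_trans _ kl)// le_ln1Dx//.
  by rewrite (@lt_trans _ _ 0)// ?ltrN10// mulr_gt0.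
have h3 : - (ln l *+ Num.truncn q) <= eps / 3 * n%:R.
  rewrite -mulNrn -[leLHS]mulr_natr.
  apply: (@le_trans _ _ (- ln l * q)); first by rewrite ler_wpM2l// truncn_le.
  rewrite /q natrM [- ln l * (_ / _)]mulrA ler_pdivrMr//.
  by have := ler_wpM2l (ltW n0) HM; lra.
set a1 := _ *+ M in h1 *; set a2 := ln (1 + _) *+ n in h2 *.
set a3 := ln l *+ _ in h3 *; set a4 := ln _ => h4.
by move: h1 h2 h3 h4; lra.
Unshelve. all: by end_near. Qed.

End covering.

Lemma lens_cover_entropy_cvg (d : measure_display) (X : measurableType d)
    (R : realType) (mu : probability X R) (T : X -> X) (k : nat)
    (U : 'I_k -> set (set (X * X) -> \bar R)) (J : nat) (A B : 'I_J -> set X) (e : R) :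
  measurable_fun setT T -> (forall A, measurable A -> mu (T @^-1` A) = mu A) ->
  ms_entropy mu T = 0%E -> 0 < e ->
  (forall j, measurable (A j) /\ measurable (B j)) ->
  (forall m, coupling mu m -> exists i, forall m', coupling mu m' ->
    (forall j, `|fine (m' (A j `*` B j)) - fine (m (A j `*` B j))| < e) -> U i m') ->
  ln ((cover_number (coupling mu) (lens T) U n)%:R : R) / n%:R @[n --> \oo] --> (0 : R).
Proof.
move=> mT muT h0 e0 mAB HU.
(* The label records membership in every [A j] and [B j]; ranking the labels turns the generated
   partition into one indexed by an ordinal. *)
pose lab x : {ffun 'I_J -> bool * bool} := [ffun j => (`[< A j x >], `[< B j x >])].
pose phi x := enum_rank (lab x).
have mphi c : measurable (phi @^-1` [set c]).
  rewrite (_ : _ @^-1` _ = \bigcap_(j in [set: 'I_J])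
      ((if (enum_val c j).1 then A j else ~` A j) `&`
       (if (enum_val c j).2 then B j else ~` B j))).
    apply: fin_bigcap_measurable => // j _; have [mA mB] := mAB j.
    by apply: measurableI; case: ifP => // _; exact: measurableC.
  apply/seteqP; split => x /=.
    move=> <- j _; rewrite enum_rankK ffunE/=.
    by split; case: asboolP.
  move=> H; rewrite /phi -[RHS]enum_valK; congr enum_rank; apply/ffunP => j.
  rewrite ffunE; have := H j I; case: (enum_val c j) => -[] [] /= [? ?];
  by congr pair; apply/asboolP.
have growth eps : 0 < eps -> \forall n \near \oo,
    ln ((cover_number (coupling mu) (lens T) U n)%:R : R) <= eps * n%:R.
  move=> eps0; refine (cover_number_growth mT muT e0 HU (phi := phi)
    (alpha := fun j c => (enum_val c j).1) (beta := fun j c => (enum_val c j).2) mphi _ _ h0 eps0).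
  - by move=> j; apply/seteqP; split => x /=; rewrite /phi enum_rankK ffunE/=; move/asboolP.
  - by move=> j; apply/seteqP; split => x /=; rewrite /phi enum_rankK ffunE/=; move/asboolP.
apply/cvgrPdist_le => eps eps0; near=> n.
have n0 : 0 < n%:R :> R by rewrite ltr0n; near: n; exact: nbhs_infty_gt.
have ln0 : 0 <= ln ((cover_number (coupling mu) (lens T) U n)%:R : R).
  case: cover_number => [|N]; first by rewrite ln0.
  by rewrite ln_ge0// ler1n.
rewrite sub0r normrN ger0_norm ?divr_ge0// ler_pdivrMr//.
by near: n; exact: growth.
Unshelve. all: by end_near. Qed.

(** * Regularity of probabilities on standard Borel spaces *)

Lemma probability_decreasing_small (d : measure_display) (T : measurableType d)
    (R : realType) (nu : probability T R) (F : (set T)^nat) (e : R) :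
  (forall n, measurable (F n)) -> nonincreasing_seq F -> \bigcap_n F n = set0 ->
  0 < e -> exists n, (nu (F n) < e%:E)%E.
Proof.
move=> mF dF F0 e0.
have : nu \o F @ \oo --> 0%E.
  rewrite -(measure0 nu) -F0; apply: nonincreasing_cvg_mu => //.
  - by rewrite (le_lt_trans (probability_le1 nu (mF _)))// ltry.
  - exact: bigcap_measurable.
move=> /fine_cvgP[fF]; move/cvgrPdist_lt => /(_ _ e0) H.
near \oo => n; exists n.
have fn : nu (F n) \is a fin_num by exact: fin_num_measure.
rewrite -(fineK fn) lte_fin.
have : `|0 - fine (nu (F n))| < e by near: n.
by rewrite sub0r normrN ger0_norm ?fine_ge0.
Unshelve. all: by end_near. Qed.

Section regularity.
Context {R : realType} (nu : probability R R).

(** Inner and outer approximation are merged into the single gap between [V] and [C], which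
    complementation preserves. *)
Definition regular_set (A : set R) := forall e : R, 0 < e ->
  exists C V : set R, [/\ closed C, open V, C `<=` A, A `<=` V &
    (nu (V `\` C) < e%:E)%E].

Lemma regular_setC A : regular_set A -> regular_set (~` A).
Proof.
move=> rA e /rA[C [V [cC oO CA AO OC]]]; exists (~` V), (~` C); split.
- exact: open_closedC.
- exact: closed_openC.
- exact: subsetC.
- exact: subsetC.
- by rewrite setDE setCK setIC -setDE.
Qed.

Lemma closed_ray_regular (x : R) : regular_set `[x, +oo[.
Proof.
move=> e e0; pose F (n : nat) : set R := `]x - n.+1%:R^-1, x[%classic.
have [|||n Hn] := @probability_decreasing_small _ _ _ nu F e _ _ _ e0.
- by move=> n; exact: measurable_itv.
- move=> m n mn; apply/subsetPset => y; rewrite /F/= !in_itv/= => /andP[h ->].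
  rewrite andbT (le_lt_trans _ h)// lerB// lef_pV2 ?posrE// ler_nat.
  by [].
- apply/seteqP; split => // y Fy.
  have yx : y < x by have := Fy 0%N I; rewrite /F/= in_itv/= => /andP[].
  have [n] := ltr_add_invr yx; move=> yn.
  have := Fy n I; rewrite /F/= in_itv/= => /andP[+ _].
  by rewrite ltrBlDr ltNge ltW.
exists `[x, +oo[%classic, `]x - n.+1%:R^-1, +oo[%classic; split => //.
- exact: interval_closed.
- by move=> y /=; rewrite !in_itv/= !andbT => xy; rewrite (lt_le_trans _ xy)// ltrBlDr ltrDl.
- rewrite (_ : _ `\` _ = F n)//; apply/seteqP; split => y; rewrite /F/= !in_itv/= !andbT.
    by move=> [-> /negP]; rewrite -ltNge.
  by move=> /andP[-> yx]; split => //; apply/negP; rewrite -ltNge.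
Qed.

(** A countable union of closed sets need not be closed, so only a finite part [CN N] is kept, at a
    cost below [e / 2] by continuity from above. The gaps of the individual sets form a geometric
    series of sum at most [e / 2]. *)
Lemma regular_set_bigcup (A : (set R)^nat) :
  (forall n, regular_set (A n)) -> regular_set (\bigcup_n A n).
Proof.
move=> rA e e0.
have e20 n : 0 < e / 2 / (2 ^ n.+1)%:R :> R by rewrite !divr_gt0// ltr0n expn_gt0.
have /choice[C /choice[V CV]] : forall n, exists C V : set R,
   [/\ closed C, open V, C `<=` A n, A n `<=` V &
    (nu (V `\` C) < (e / 2 / (2 ^ n.+1)%:R)%:E)%E] by move=> n; exact: rA.
have mC n : measurable (C n) by apply: closed_measurable; have [] := CV n.
have mO n : measurable (V n) by apply: open_measurable; have [] := CV n.
have mUC : measurable (\bigcup_n C n) by exact: bigcupT_measurable.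
have mUO : measurable (\bigcup_n V n) by exact: bigcupT_measurable.
pose CN N := \big[setU/set0]_(i < N) C i.
have mCN N : measurable (CN N) by exact: bigsetU_measurable.
have [||||N HN] := @probability_decreasing_small _ _ _ nu
    (fun N => (\bigcup_n C n) `\` CN N) (e / 2).
- by move=> N; exact: measurableD.
- move=> m n mn; apply/subsetPset; apply: setDS; exact: subset_bigsetU.
- apply/seteqP; split => // x Hx; have [[n _ Cx] _] := Hx 0%N I.
  by have [_] := Hx n.+1 I; apply; rewrite /CN -bigcup_mkord; exists n => /=.
- by rewrite divr_gt0.
exists (CN N), (\bigcup_n V n); split.
- apply: closed_bigsetU => i _; by have [] := CV i.
- by apply: bigcup_open => n _; have [] := CV n.
- rewrite /CN -bigcup_mkord => x [n _ Cx]; exists n => //.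
  by have [_ _ + _ _] := CV n; apply.
- by move=> x [n _ Ax]; exists n => //; have [_ _ _ + _] := CV n; apply.
have sub : (\bigcup_n V n) `\` CN N `<=`
    (\bigcup_n (V n `\` C n)) `|` ((\bigcup_n C n) `\` CN N).
  move=> x [[n _ Ox] nC]; have [Cx|nCx] := pselect ((\bigcup_n C n) x).
    by right.
  by left; exists n => //; split => // Cx; apply: nCx; exists n.
have mD : measurable (\bigcup_n (V n `\` C n)).
  by apply: bigcupT_measurable => n; exact: measurableD.
apply: (@le_lt_trans _ _ (nu (\bigcup_n (V n `\` C n)) + nu ((\bigcup_n C n) `\` CN N))%E).
  apply: (@le_trans _ _ (nu ((\bigcup_n (V n `\` C n)) `|` ((\bigcup_n C n) `\` CN N)))).
    apply: le_measure => //; rewrite inE; first exact: measurableD.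
    by apply: measurableU => //; exact: measurableD.
  by apply: measureU2 => //; exact: measurableD.
rewrite (splitr e) EFinD; apply: lee_ltD => //; first exact: fin_num_measure.
apply: (@le_trans _ _ (\sum_(n <oo) nu (V n `\` C n))%E).
  by apply: measure_sigma_subadditive => // n; exact: measurableD.
apply: le_trans (epsilon_trick0 xpredT _); last by rewrite divr_ge0// ltW.
by apply: lee_nneseries => // n _; apply/ltW; have [] := CV n.
Qed.

Lemma measurable_regular (A : set R) : measurable A -> regular_set A.
Proof.
rewrite /measurable/= /measurableR RGenCInfty.measurableE => mA.
apply: mA; split.
  split.
  - move=> e e0; exists set0, set0; split; [exact: closed0|exact: open0|by []|by []|].
    by rewrite setD0 measure0.
  - by move=> B rB; rewrite setTD; exact: regular_setC.
  - exact: regular_set_bigcup.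
by move=> _ [x ->]; exact: closed_ray_regular.
Qed.

End regularity.

(** Regularity on the line, pulled back along the Borel isomorphism. The map [f] is chosen before
    [A], so preimages of compact and open sets can be compared for several sets at once. *)
Lemma standard_borel_approx (d : measure_display) (X : measurableType d)
    (R : realType) (mu : probability X R) :
  standard_borel X R -> exists2 f : X -> R, measurable_fun setT f &
  forall (A : set X) (e : R), measurable A -> 0 < e -> exists K V : set R,
    [/\ compact K, open V, K `<=` f @` A, A `<=` f @^-1` V &
        f @^-1` K `<=` A /\
        (mu (A `\` f @^-1` K) < e%:E)%E /\ (mu (f @^-1` V `\` A) < e%:E)%E].
Proof.
move=> [S [f [g [mS mf mg Sf [gf fg]]]]]; exists f => // A e mA e0.
have pre B : measurable B -> measurable (f @^-1` B).
  by move=> mB; rewrite -[X in measurable X]setTI; exact: mf.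
pose F : {mfun X >-> R} := mfun_Sub (mem_set mf).
pose nu := distribution mu F.
(* This set is the image of [A] under [f]. *)
have mA' : measurable (S `&` g @^-1` A) by exact: mg.
have e20 : 0 < e / 2 by rewrite divr_gt0.
have [C [V [cC oV CA AV nuVC]]] := measurable_regular nu mA' e20.
have mC := closed_measurable cC; have mV := open_measurable oV.
(* Intersecting the closed set with a large segment makes it compact; the rest of the line has mass
   below [e / 2]. *)
pose I_ (n : nat) : set R := `[- n%:R, n%:R]%classic.
have [|||n Hn] := @probability_decreasing_small _ _ _ nu (fun n => ~` I_ n) (e / 2) _ _ _ e20.
- by move=> n; apply: measurableC; exact: measurable_itv.
- move=> m n mn; apply/subsetPset; apply: subsetC => y; rewrite /I_/= !in_itv/= => /andP[h1 h2].
  by rewrite (le_trans _ h1) ?(le_trans h2) ?lerN2 ?ler_nat.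
- apply/seteqP; split => // y Hy; have := Hy (Num.bound y) I; apply.
  rewrite /I_/= in_itv/= -ler_norml.
  by have := archi_boundP (normr_ge0 y); rewrite /Num.bound normr_id => /ltW.
have mI : measurable (I_ n) by exact: measurable_itv.
exists (C `&` I_ n), V.
have KA : C `&` I_ n `<=` f @` A.
  by move=> y [/CA[Sy Ay] _]; exists (g y) => //; exact: fg.
have KA' : f @^-1` (C `&` I_ n) `<=` A.
  by move=> x /= [/CA[_]]; rewrite /= gf.
have AV' : A `<=` f @^-1` V.
  by move=> x Ax; apply: AV; split; [exact: Sf|rewrite /= gf].
have mK : measurable (C `&` I_ n) by exact: measurableI.
split => //.
- apply: (@subclosed_compact _ _ (I_ n)); last exact: subIsetr.
    by apply: closedI => //; exact: interval_closed.
  exact: segment_compact.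
split => //.
have VCe : (nu (V `\` C) + nu (~` I_ n) < e%:E)%E.
  by rewrite (splitr e) EFinD lteD.
split.
  apply: le_lt_trans VCe; apply: le_trans (measureU2 _ _ _) => //.
  - apply: (@le_measure _ _ _ mu _ (f @^-1` (V `\` C `|` ~` I_ n))); rewrite ?inE.
    + by apply: measurableD => //; exact: pre.
    + apply: pre; apply: measurableU; [exact: measurableD|exact: measurableC].
    + move=> x [Ax nK]; have [Ix|nIx] := pselect (I_ n (f x)); last by right.
      by left; split; [exact: AV'|move=> Cx; apply: nK].
  - exact: measurableD.
  - exact: measurableC.
apply: le_lt_trans VCe; apply: (@le_trans _ _ (nu (V `\` C))); last by rewrite leeDl.
apply: (@le_measure _ _ _ mu _ (f @^-1` (V `\` C))); rewrite ?inE.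
- by apply: measurableD => //; exact: pre.
- by apply: pre; exact: measurableD.
- move=> x [Vx nAx]; split => // Cx; apply: nAx.
  by have [_] := CA _ Cx; rewrite /= gf.
Qed.

Section fine_probability.
Context {d : measure_display} {Z : measurableType d} {R : realType}.
Variable rho : probability Z R.

Lemma fine_probability_le (E F : set Z) : measurable E -> measurable F ->
  E `<=` F -> fine (rho E) <= fine (rho F).
Proof.
move=> mE mF EF; apply: fine_le; [exact: fin_num_measure..|].
by apply: le_measure; rewrite ?inE.
Qed.

Lemma fine_probabilityU (E F : set Z) : measurable E -> measurable F ->
  fine (rho (E `|` F)) <= fine (rho E) + fine (rho F).
Proof.
move=> mE mF; rewrite -fineD ?fin_num_measure//.
apply: fine_le; [|by rewrite fin_numD !fin_num_measure|exact: measureU2].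
by apply: fin_num_measure; exact: measurableU.
Qed.

Lemma fine_probability_bigsetU (F : nat -> set Z) N :
  (forall i, measurable (F i)) ->
  fine (rho (\big[setU/set0]_(i < N) F i)) <= \sum_(i < N) fine (rho (F i)).
Proof.
move=> mF; elim: N => [|N IH]; first by rewrite !big_ord0 measure0.
rewrite !big_ord_recr/=; apply: le_trans (fine_probabilityU _ _) _ => //.
  by apply: bigsetU_measurable => i _.
by rewrite lerD2r.
Qed.

End fine_probability.

(** The part of the first rectangle outside the second lies in the two strips over [A \ A'] and
    [B \ B'], whose masses are marginal and hence the same for all couplings. *)
Lemma coupling_rectangle_le (d : measure_display) (X : measurableType d)
    (R : realType) (mu : probability X R) m (A B A' B' : set X) :
  coupling mu m -> measurable A -> measurable B -> measurable A' -> measurable B' ->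
  fine (m (A `*` B)) <=
    fine (m (A' `*` B')) + (fine (mu (A `\` A')) + fine (mu (B `\` B'))).
Proof.
move=> [rho [<- Hrho]] mA mB mA' mB'.
have mAA' : measurable (A `\` A') by exact: measurableD.
have mBB' : measurable (B `\` B') by exact: measurableD.
have [<- _] := Hrho _ mAA'; have [_ <-] := Hrho _ mBB'.
have mU : measurable ((A `\` A') `*` [set: X] `|` [set: X] `*` (B `\` B')).
  by apply: measurableU; exact: measurableX.
apply: (@le_trans _ _ (fine (rho (A' `*` B' `|` ((A `\` A') `*` [set: X]
    `|` [set: X] `*` (B `\` B')))))).
  apply: fine_probability_le; first exact: measurableX.
    by apply: measurableU => //; exact: measurableX.
  move=> [x y] [/= Ax By]; have [A'x|] := pselect (A' x); last by right; left.
  by have [B'y|] := pselect (B' y); [left|right; right].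
apply: le_trans (fine_probabilityU _ _ _) _ => //; first exact: measurableX.
by rewrite lerD2l; apply: fine_probabilityU; exact: measurableX.
Qed.

(* Uniformity of N in the coupling is what survives a limit of couplings. *)
Lemma coupling_rectangle_subadditive (d : measure_display) (X : measurableType d)
    (R : realType) (mu : probability X R) (A B : set X) (F G : (set X)^nat) (e : R) :
  standard_borel X R -> measurable A -> measurable B ->
  (forall i, measurable (F i)) -> (forall i, measurable (G i)) ->
  A `*` B `<=` \bigcup_i (F i `*` G i) -> 0 < e ->
  exists N, forall m, coupling mu m ->
    fine (m (A `*` B)) <= \sum_(i < N) fine (m (F i `*` G i)) + e.
Proof.
move=> /(standard_borel_approx mu)[f mf approx] mA mB mF mG ABFG e0.
have pre C : measurable C -> measurable (f @^-1` C).
  by move=> mC; rewrite -[X in measurable X]setTI; exact: mf.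
have e40 : 0 < e / 4 by rewrite divr_gt0.
have ei0 (i : nat) : 0 < e / 4 / (2 ^ i.+1)%:R :> R.
  by rewrite !divr_gt0// ltr0n expn_gt0.
have [K [_ [cK _ KA _ [_ [muK _]]]]] := approx A _ mA e40.
have [L [_ [cL _ LB _ [_ [muL _]]]]] := approx B _ mB e40.
have /choice[V HV] : forall i, exists V, [/\ open V, F i `<=` f @^-1` V &
    (mu (f @^-1` V `\` F i) < (e / 4 / (2 ^ i.+1)%:R)%:E)%E].
  by move=> i; have [_ [V [_ oV _ FV [_ [_ muV]]]]] := approx (F i) _ (mF i) (ei0 i); exists V.
have /choice[W HW] : forall i, exists V, [/\ open V, G i `<=` f @^-1` V &
    (mu (f @^-1` V `\` G i) < (e / 4 / (2 ^ i.+1)%:R)%:E)%E].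
  by move=> i; have [_ [V' [_ oV _ FV [_ [_ muV]]]]] := approx (G i) _ (mG i) (ei0 i); exists V'.
have mV i : measurable (V i) by apply: open_measurable; have [] := HV i.
have mW i : measurable (W i) by apply: open_measurable; have [] := HW i.
have mK : measurable K by exact: compact_measurable.
have mL : measurable L by exact: compact_measurable.
(* Compactness of [K x L] extracts a finite subcover from the open rectangles. Only sets are
   involved here, so [N] does not depend on a coupling. *)
have [N KLN] : exists N, forall z, (K `*` L) z -> exists2 i, (i < N)%N & (V i `*` W i) z.
  have /compact_near_coveringP/(_ nat \oo
    (fun N z => exists2 i, (i < N)%N & (V i `*` W i) z)) := compact_setX cK cL.
  have cov z : (K `*` L) z -> \forall z' \near z & N \near \oo,
      exists2 i, (i < N)%N & (V i `*` W i) z'.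
    move: z => [z1 z2] [/= /KA[x Ax <-] /LB[y By <-]].
    have [i _ [/= Fx Gy]] := ABFG (x, y) (conj Ax By).
    have [oV FV _] := HV i; have [oW GW _] := HW i.
    exists (V i `*` W i, [set N | (i < N)%N]) => /=.
      split; last exact: nbhs_infty_gt.
      by exists (V i, W i) => //; split; apply: open_nbhs_nbhs; split => //;
        [exact: FV|exact: GW].
    by move=> [z N] [/= VWz iN]; exists i.
  by move=> /(_ _ cov)[N _ HN]; exists N => z KLz; apply: (HN N) => //=.
exists N => m cm.
have small C r : measurable C -> (mu C < r%:E)%E -> fine (mu C) <= r.
  by move=> mC Cr; rewrite -lee_fin fineK ?fin_num_measure// ltW.
apply: le_trans (coupling_rectangle_le cm mA mB (pre _ mK) (pre _ mL)) _.
have muKL : fine (mu (A `\` f @^-1` K)) + fine (mu (B `\` f @^-1` L)) <= e / 2.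
  have := small _ _ (measurableD mA (pre _ mK)) muK.
  have := small _ _ (measurableD mB (pre _ mL)) muL; lra.
have mKL : fine (m ((f @^-1` K) `*` (f @^-1` L))) <=
    \sum_(i < N) fine (m ((f @^-1` V i) `*` (f @^-1` W i))).
  case: cm => rho [<- _].
  apply: le_trans (fine_probability_bigsetU rho
    (F := fun i => (f @^-1` V i) `*` (f @^-1` W i)) N _); last first.
    by move=> i; apply: measurableX; exact: pre.
  apply: fine_probability_le; first by apply: measurableX; exact: pre.
    by apply: bigsetU_measurable => i _; apply: measurableX; exact: pre.
  move=> [x y] [/= Kx Ly]; have [i iN [Vx Wy]] := KLN (f x, f y) (conj Kx Ly).
  by rewrite -(bigcup_mkord N (fun i => (f @^-1` V i) `*` (f @^-1` W i))); exists i.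
(* Each index loses twice [e / 4 / 2 ^ (i + 1)], once per factor; the losses sum to at most [e / 2],
   the other half having been spent on [K] and [L]. *)
have sumVW : \sum_(i < N) fine (m ((f @^-1` V i) `*` (f @^-1` W i))) <=
    \sum_(i < N) fine (m (F i `*` G i)) + e / 2.
  apply: (@le_trans _ _ (\sum_(i < N) (fine (m (F i `*` G i)) + e / 2 / (2 ^ i.+1)%:R))).
    apply: ler_sum => i _.
    apply: le_trans (coupling_rectangle_le cm (pre _ (mV i)) (pre _ (mW i)) (mF i) (mG i)) _.
    rewrite lerD2l.
    have [_ _ hV] := HV i; have [_ _ hW] := HW i.
    have := small _ _ (measurableD (pre _ (mV i)) (mF i)) hV.
    have := small _ _ (measurableD (pre _ (mW i)) (mG i)) hW.
    have -> : e / 2 / (2 ^ i.+1)%:R = e / 4 / (2 ^ i.+1)%:R + e / 4 / (2 ^ i.+1)%:R :> R.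
      by rewrite -mulrDl; congr (_ / _); field.
    by lra.
  rewrite big_split/= lerD2l.
  have -> : \sum_(i < N) e / 2 / (2 ^ i.+1)%:R = e / 2 * (1 - (2 ^ N)%:R^-1) :> R.
    elim: {KLN mKL} N => [|N IH]; first by rewrite big_ord0 expn0 invr1 subrr mulr0.
    rewrite big_ord_recr/= IH expnS natrM; field.
    by rewrite pnatr_eq0 -lt0n expn_gt0.
  by rewrite ler_piMr ?divr_ge0 ?(ltW e0)// gerBl invr_ge0.
by lra.
Qed.

(** * Extension from rectangles *)

Section rectangles.
Context {d : measure_display} (X : measurableType d).

Definition rectangle : set (set (X * X)) :=
  [set A `*` B | A in measurable & B in measurable].

Lemma rectangle0 : rectangle set0.
Proof. by exists set0 => //; exists set0 => //; rewrite setX0. Qed.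

Lemma rectangleI : setI_closed rectangle.
Proof.
move=> _ _ [A mA [B mB <-]] [C mC [D mD <-]]; rewrite -setXI.
by exists (A `&` C); [exact: measurableI|exists (B `&` D) => //; exact: measurableI].
Qed.

Lemma rectangleD : semi_setD_closed rectangle.
Proof.
move=> _ _ [A mA [B mB <-]] [C mC [D mD <-]].
(* Cutting first along [C] and only then along [D] keeps the two pieces disjoint. *)
exists [set (A `\` C) `*` B; (A `&` C) `*` (B `\` D)]; split.
- exact: finite_set2.
- move=> _ [->|->].
    by exists (A `\` C); [exact: measurableD|exists B].
  by exists (A `&` C); [exact: measurableI|exists (B `\` D) => //; exact: measurableD].
- rewrite bigcup_setU1 bigcup_set1; apply/seteqP; split => -[x y] /=.
    move=> [[Ax By] nCD]; have [Cx|nCx] := pselect (C x); last by left.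
    by right; split => //; split => // Dy; exact: nCD.
  by move=> [[[Ax nCx] By]|[[Ax Cx] [By nDy]]]; split => // -[].
- move=> _ _ [->|->] [->|->] // [[x y]] [[/= h1 h2] [/= h3 h4]]; exfalso.
    by case: h1 => _; apply; case: h3.
  by case: h3 => _; apply; case: h1.
Qed.

(** A copy of the product that carries the semiring of rectangles, kept apart from the product
    sigma-algebra. *)
Definition rectangle_type : Type := (X * X)%type.

Definition rectangle_display : measure_display. Proof. exact: d. Qed.

HB.instance Definition _ := Pointed.on rectangle_type.
HB.instance Definition _ := @isSemiRingOfSets.Build rectangle_display
  rectangle_type rectangle rectangle0 rectangleI rectangleD.

End rectangles.

Section rectangle_extension.
Context {d : measure_display} {X : measurableType d} {R : realType}.
Variable q : set (X * X) -> R.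
Hypothesis q_ge0 : forall E, 0 <= q E.
Hypothesis qT : q setT = 1.
Hypothesis qU : forall E F, measurable E -> measurable F -> E `&` F = set0 ->
  q (E `|` F) = q E + q F.
Hypothesis q_subadditive : forall (A B : set X) (F G : (set X)^nat) (e : R),
  measurable A -> measurable B ->
  (forall i, measurable (F i)) -> (forall i, measurable (G i)) ->
  A `*` B `<=` \bigcup_i (F i `*` G i) -> 0 < e ->
  exists N, q (A `*` B) <= \sum_(i < N) q (F i `*` G i) + e.

Let qE (E : set (rectangle_type X)) : \bar R := (q E)%:E.

Let qE_ge0 E : (0 <= qE E)%E. Proof. by rewrite lee_fin. Qed.

Let measurable_rectangle (E : set (X * X)) : rectangle E -> measurable E.
Proof. by move=> [A mA [B mB <-]]; exact: measurableX. Qed.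

Let qE_semi_additive : measure_function.semi_additive qE.
Proof.
move=> F n mF tF _; rewrite /qE sumEFin; congr EFin.
have q0 : q set0 = 0.
  have := qU measurable0 measurable0 (setI0 set0); rewrite setU0 => /eqP.
  by rewrite -[X in X == _]addr0 (inj_eq (addrI _)) eq_sym => /eqP.
have mF' i : measurable (F i : set (X * X)).
  by apply: measurable_rectangle; exact: mF.
elim: n => [|n IH]; first by rewrite !big_ord0.
rewrite !big_ord_recr/= qU ?IH//; first exact: bigsetU_measurable.
apply/seteqP; split => // z []; rewrite -bigcup_mkord => -[i /= lt_in Fiz] Fnz.
have : i = n by apply: tF => //; exists z.
by move=> i_n; rewrite i_n ltnn in lt_in.
Qed.

HB.instance Definition _ := isContent.Build _ _ R qE qE_ge0 qE_semi_additive.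

(** The finite sums of [q_subadditive] are dominated by the full series since the terms are
    nonnegative; then the slack [e] tends to zero. *)
Let qE_sigma_subadditive : measurable_subset_sigma_subadditive qE.
Proof.
move=> E F mF [A mA [B mB <-]] EF.
have /choice[F1 /choice[F2 HF]] : forall n, exists A B, [/\ measurable A, measurable B
   & F n = A `*` B].
  by move=> n; have [A' mA' [B' mB' <-]] := mF n; exists A', B'.
have mF1 n : measurable (F1 n) by have [] := HF n.
have mF2 n : measurable (F2 n) by have [] := HF n.
have FE n : F n = F1 n `*` F2 n by have [] := HF n.
apply/lee_addgt0Pr => e e0.
have [N HN] : exists N, q (A `*` B) <= \sum_(i < N) q (F1 i `*` F2 i) + e.
  apply: q_subadditive => //; apply: subset_trans EF _.
  by apply: subset_bigcup => i _; rewrite FE.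
apply: (@le_trans _ _ ((\sum_(i < N) q (F1 i `*` F2 i))%:E + e%:E)%E).
  by rewrite -EFinD lee_fin.
rewrite leeD2r// -sumEFin.
rewrite -(big_mkord xpredT (fun i => (q (F1 i `*` F2 i))%:E)).
rewrite (eq_bigr (fun i => qE (F i))); last by move=> i _; rewrite /qE FE.
exact: nneseries_lim_ge.
Qed.

HB.instance Definition _ := Content_SigmaSubAdditive_isMeasure.Build _ _ _
  qE qE_sigma_subadditive.

Let rho (E : set (X * X)) : \bar R := measure_extension qE E.

Let measurable_sigma (E : set (X * X)) : measurable E ->
  measurable (E : set (g_sigma_algebraType (@measurable _ (rectangle_type X)))).
Proof. by rewrite measurable_prod_measurableType. Qed.

Let rho0 : rho set0 = 0%E. Proof. exact: measure0. Qed.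
Let rho_ge0 E : (0 <= rho E)%E. Proof. exact: measure_ge0. Qed.
Let rho_sigma_additive : semi_sigma_additive rho.
Proof.
move=> F mF tF mUF; apply: (@measure_semi_sigma_additive _ _ _ (measure_extension qE)) => //.
  by move=> i; exact: measurable_sigma.
exact: measurable_sigma.
Qed.

HB.instance Definition _ := isMeasure.Build _ _ _ rho rho0 rho_ge0 rho_sigma_additive.

Let rhoE A B : measurable A -> measurable B -> rho (A `*` B) = (q (A `*` B))%:E.
Proof.
move=> mA mB; rewrite /rho /measure_extension measurable_mu_extE//.
by exists A => //; exists B.
Qed.

Let rhoT : rho setT = 1%E.
Proof. by rewrite -setXTT rhoE// setXTT qT. Qed.

HB.instance Definition _ := Measure_isProbability.Build _ _ _ rho rhoT.

(** Carathéodory's extension from the semiring of rectangles, restricted to the product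
    sigma-algebra that they generate. Agreement with [q] is obtained on rectangles only. *)
Lemma rectangle_extension : exists P : probability (X * X)%type R,
  forall A B, measurable A -> measurable B -> P (A `*` B) = (q (A `*` B))%:E.
Proof. by exists rho. Qed.

End rectangle_extension.

(** * Compactness of the space of couplings *)

(** Compactness of the segment gives a cluster point, and a cluster point of an ultrafilter is a
    limit. *)
Lemma ultrafilter_bounded_cvg (Y : Type) (R : realType) (F : set_system Y)
    (f : Y -> R) (a b : R) : UltraFilter F -> F [set y | a <= f y <= b] ->
  exists2 l, a <= l <= b & f y @[y --> F] --> l.
Proof.
move=> UF Fab.
have /(_ (f @ F) _ _)[|l [lab lF]] := @segment_compact R a b.
  change (F (f @^-1` `[a, b]%classic)); apply: filterS Fab => y /=.
  by rewrite in_itv.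
exists l; first by move: lab; rewrite /= in_itv/=.
move=> B Bl /=; have [//|FnB] := in_ultra_setVsetC (f @^-1` B) UF.
have : (f @ F) (~` B) by exact: FnB.
by move=> /lF/(_ Bl) [z [nBz Bz]].
Qed.

Lemma coupling_ultralimit (d : measure_display) (X : measurableType d)
    (R : realType) (mu : probability X R) (F : set_system (set (X * X) -> \bar R)) :
  standard_borel X R -> UltraFilter F -> F (coupling mu) ->
  exists2 m0, coupling mu m0 & forall A B, measurable A -> measurable B ->
    fine (m (A `*` B)) @[m --> F] --> fine (m0 (A `*` B)).
Proof.
move=> sbX UF Fmu.
(* The limit is taken on all measurable sets, which makes finite additivity immediate; elsewhere [q]
   has the default value 0. *)
have /choice[q Hq] : forall E : set (X * X), exists l : R,
    0 <= l /\ (measurable E -> fine (m E) @[m --> F] --> l).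
  move=> E; have [mE|] := pselect (measurable E); last by exists 0.
  have [|l /andP[l0 _] lE] := @ultrafilter_bounded_cvg _ _ _
      (fun m : set (X * X) -> \bar R => fine (m E)) 0 1 UF.
    apply: filterS Fmu => m [rho [<- _]] /=.
    by rewrite fine_ge0//= -lee_fin fineK ?fin_num_measure// probability_le1.
  by exists l.
have q0 E : 0 <= q E by have [] := Hq E.
have {Hq}qF E : measurable E -> fine (m E) @[m --> F] --> q E by have [] := Hq E.
have q_eq E l : measurable E -> (forall m, coupling mu m -> fine (m E) = l) -> q E = l.
  move=> mE El; apply: (@cvg_unique _ (@Rhausdorff R) (fine (m E) @[m --> F])).
    exact: qF.
  apply: cvg_near_cst; apply: filterS Fmu => m cm; exact: El.
have qU E G : measurable E -> measurable G -> E `&` G = set0 ->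
    q (E `|` G) = q E + q G.
  move=> mE mG EG; apply: (@cvg_unique _ (@Rhausdorff R) (fine (m (E `|` G)) @[m --> F])).
    by apply: qF; exact: measurableU.
  apply: (@cvg_trans _ ((fine (m E) + fine (m G)) @[m --> F])); last first.
    by apply: cvgD; exact: qF.
  apply: near_eq_cvg; apply: filterS Fmu => m [rho [<- _]].
  by rewrite measureU// fineD// fin_num_measure.
have qsub (A B : set X) (G H : (set X)^nat) (e : R) :
  measurable A -> measurable B ->
  (forall i, measurable (G i)) -> (forall i, measurable (H i)) ->
  A `*` B `<=` \bigcup_i (G i `*` H i) -> 0 < e ->
  exists N, q (A `*` B) <= \sum_(i < N) q (G i `*` H i) + e.
  move=> mA mB mG mH ABGH e0.
  have [N HN] := coupling_rectangle_subadditive mu sbX mA mB mG mH ABGH e0.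
  (* As [N] is common to all couplings, this is one inequality between finite sums, and it passes to
     the limit. *)
  exists N; rewrite -subr_ge0.
  apply: (@cvgr_to_ge _ F _ _ (fun m => \sum_(i < N) fine (m (G i `*` H i)) + e
     - fine (m (A `*` B)))).
    apply: cvgB; last by apply: qF; exact: measurableX.
    apply: cvgD; last exact: cvg_cst.
    elim: {HN} N => [|N IH].
      by under eq_cvg do rewrite big_ord0; rewrite big_ord0; exact: cvg_cst.
    under eq_cvg do rewrite big_ord_recr/=; rewrite big_ord_recr/=.
    by apply: cvgD => //; apply: qF; exact: measurableX.
  by apply: filterS Fmu => m cm; rewrite /= subr_ge0; exact: HN.
have mTT : measurable [set: X * X] by exact: measurableT.
have qT : q setT = 1.
  by apply: q_eq => // m [rho [<- _]]; rewrite probability_setT.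
have [rho Hrho] := rectangle_extension q0 qT qU qsub.
exists (rho : set (X * X) -> \bar R).
  exists rho; split => // A mA; rewrite !Hrho//.
  split; rewrite -[RHS](fineK (fin_num_measure mu _ mA)); congr EFin;
  apply: q_eq => [|m [r [<- Hr]]]; try exact: measurableX.
  - by have [->] := Hr A mA.
  - by have [_ ->] := Hr A mA.
by move=> A B mA mB; rewrite Hrho//; apply: qF; exact: measurableX.
Qed.

(** By contradiction: if every finite list of rectangles and every precision admit a bad coupling,
    the bad sets generate a filter. An ultrafilter above it converges to a coupling [m0] in some
    [U i], and a basic neighbourhood of [m0] inside [U i] excludes bad couplings near [m0]. *)
Lemma lens_lebesgue_number (d : measure_display) (X : measurableType d)
    (R : realType) (mu : probability X R) (k : nat)
    (U : 'I_k -> set (set (X * X) -> \bar R)) :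
  standard_borel X R -> (forall i, lens_open mu (U i)) ->
  coupling mu `<=` \bigcup_i U i ->
  exists (J : nat) (A B : 'I_J -> set X) (e : R),
  [/\ 0 < e, forall j, measurable (A j) /\ measurable (B j) &
    forall m, coupling mu m -> exists i, forall m', coupling mu m' ->
      (forall j, `|fine (m' (A j `*` B j)) - fine (m (A j `*` B j))| < e) -> U i m'].
Proof.
move=> sbX oU covU; apply: contrapT => none.
pose meas (s : seq (set X * set X)) :=
  all (fun AB => `[< measurable AB.1 >] && `[< measurable AB.2 >]) s.
pose close s (e : R) (m m' : set (X * X) -> \bar R) := all (fun AB : set X * set X =>
  `|fine (m' (AB.1 `*` AB.2)) - fine (m (AB.1 `*` AB.2))| < e) s.
pose D := [set se : seq (set X * set X) * R | meas se.1 /\ 0 < se.2].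
pose bad (se : seq (set X * set X) * R) := [set m | coupling mu m /\ forall i,
  exists m', [/\ coupling mu m', close se.1 se.2 m m' & ~ U i m']].
have bad_nonempty se : D se -> bad se !=set0.
  case: se => s e [/= ms e0]; apply: contrapT => nbad; apply: none.
  exists (size s), (fun j => (nth (set0, set0) s j).1),
    (fun j => (nth (set0, set0) s j).2), e; split => //.
    move=> j; move/(all_nthP (set0, set0)): ms => /(_ j (ltn_ord j)).
    by move=> /andP[/asboolP ? /asboolP ?].
  move=> m cm; apply: contrapT => nU; apply: nbad; exists m; split => // i.
  apply: contrapT => nm'; apply: nU; exists i => m' cm' Hm'.
  apply: contrapT => nUm'; apply: nm'; exists m'; split => //.
  by apply/(all_nthP (set0, set0)) => j js; have := Hm' (Ordinal js).
have close_le s e1 e2 m m' : e1 <= e2 -> close s e1 m m' -> close s e2 m m'.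
  by move=> e12; apply: sub_all => AB /lt_le_trans; apply.
have badF : ProperFilter (filter_from D bad).
  apply: filter_from_proper => //; apply: filter_from_filter.
    by exists ([::], 1); split.
  move=> [s1 e1] [s2 e2] [/= ms1 e10] [/= ms2 e20].
  (* More rectangles and a smaller precision shrink the bad set, so the bad sets form a filter
     base. *)
  exists (s1 ++ s2, Num.min e1 e2).
    by split; rewrite /= ?lt_min ?e10// /meas all_cat -/(meas _) ms1.
  move=> m [cm Hm]; split; split => // i; have [m' [cm' + nU]] := Hm i;
  rewrite /= /close all_cat => /andP[c1 c2]; exists m'; split => //=.
    by apply: close_le c1; rewrite ge_min lexx.
  by apply: close_le c2; rewrite ge_min lexx orbT.
have [F [UF badF']] := ultraFilterLemma badF.
have Fmu : F (coupling mu).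
  by apply: badF'; exists ([::], 1) => [|m [] //]; split.
have [m0 cm0 Fm0] := coupling_ultralimit sbX UF Fmu.
have [i _ Um0] := covU _ cm0.
have [n [A [B [e [e0 mAB He]]]]] := oU i _ cm0 Um0.
pose s := [seq (A j, B j) | j <- enum 'I_n].
have ms : meas s.
  rewrite /meas all_map; apply/allP => j _ /=; have [mA mB] := mAB j.
  by apply/andP; split; apply/asboolP.
(* Half for the distance from [m0] to a bad coupling, half for the distance from there to its
   witness outside [U i]. *)
have e20 : 0 < e / 2 by rewrite divr_gt0.
have Fclose : F [set m | close s (e / 2) m0 m].
  elim: s ms => [_|[A' B'] s IH /= /andP[/andP[/asboolP mA' /asboolP mB'] /IH Fs]].
    by apply: filterS filterT => m.
  have /cvgrPdist_lt/(_ _ e20) := Fm0 _ _ mA' mB'.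
  by move=> /(filterI Fs); apply: filterS => m [sm m0m]; rewrite /close/= distrC m0m.
have Fbad : F (bad (s, e / 2)) by apply: badF'; exists (s, e / 2).
have [m [m0m [cm /(_ i)[m' [cm' mm' []]]]]] := filter_ex (filterI Fclose Fbad).
apply: He => // j.
have js : (j < size s)%N by rewrite size_map size_enum_ord.
move/(all_nthP (set0, set0)) : m0m => /(_ j js).
move/(all_nthP (set0, set0)) : mm' => /(_ j js).
rewrite (nth_map j) ?size_enum_ord// nth_ord_enum/= !ltr_distl; lra.
Qed.

Theorem mainTheorem14 (d : measure_display) (X : measurableType d)
  (R : realType) (mu : probability X R) (T : X -> X) :
  standard_borel X R ->
  mp_automorphism mu T ->
  ergodic mu T ->
  ms_entropy mu T = 0%E ->
  top_entropy R (lens_open mu) (coupling mu) (lens T) = 0%E.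
Proof.
move=> sbX [_ [_ _ mT _ muT]] _ h0.
have cover0 k (U : 'I_k -> set (set (X * X) -> \bar R)) :
    (forall i, lens_open mu (U i)) -> coupling mu `<=` \bigcup_i U i ->
    cover_entropy R (coupling mu) (lens T) U = 0.
  move=> oU covU; have [J [A [B [e [e0 mAB HU]]]]] := lens_lebesgue_number sbX oU covU.
  exact/cvg_lim/(lens_cover_entropy_cvg mT muT h0 e0 mAB HU).
apply/eqP; rewrite eq_le; apply/andP; split.
  by apply: ge_ereal_sup => _ [k [U [oU covU ->]]]; rewrite cover0.
(* The one-member cover by the whole space realizes the value 0, so the supremum is not that of an
   empty set. *)
apply: ereal_sup_ubound; exists 1%N, (fun=> setT).
have oT (i : 'I_1) : lens_open mu setT.
  move=> m _ _; exists 0%N, (fun=> set0), (fun=> set0), 1.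
  by split => //.
have covT : coupling mu `<=` \bigcup_(i : 'I_1) setT by move=> m _; exists ord0.
by split => //; rewrite cover0.
Qed.
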